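(* Let $(f_i)_{i=1}^\infty$ be a sequence of maps, each as in the setting below and each satisfying conditions (i) and (ii). Then the set of numbers $x\in[0,1)$ such that, for every $i\in\mathbb N$ and every $m\in\mathbb N$, $x$ is not $m$-normal to $f_i$, has Hausdorff dimension $1$.
   Context: Setting: $f\colon[0,1)\to[0,1)$ and $g_f\ge 2$ is an integer such that $[0,1)$ is partitioned into $g_f$ half-open intervals $[a,b)$, enumerated as $[0],\dots,[g_f-1]$, such that on each of them $f$ is monotone and maps onto $[0,1)$, and $|f(x)-f(y)|\ge |x-y|$ for all $x,y$ in the same interval. For a word $x_1\dots x_n$ over $\{0,\dots,g_f-1\}$ the generation-$n$ cylinder is $C_{x_1\dots x_n}=\{x\in[0,1): f^{i-1}(x)\in[x_i],\ i=1,\dots,n\}$; $[0,1)$ is the generation-$0$ cylinder. It is assumed that $|C_{x_1\dots x_n}|\to 0$ as $n\to\infty$ for every $(x_i)\in\{0,\dots,g_f-1\}^{\mathbb N}$, so each $x\in[0,1)$ has a unique coding sequence $(x_i)_{i\ge1}$ (its $f$-expansion). Condition (i) (bounded distortion): there is $K_f>0$ such that for every cylinder $C_{x_1\dots x_n}$ (including $[0,1)$), $|(f^n)'(y)|/|(f^n)'(z)|<K_f$ for all $y,z\in C_{x_1\dots x_n}$; this implies $|C_{x_1\dots x_{n+1}}|/|C_{x_1\dots x_n}|>1/(g_fK_f)$ for all sequences and all $n$. Frequencies: for $m\in\mathbb N$ enumerate the $g_f^m$ words of length $m$ as $w_1,\dots,w_{g_f^m}$. For $x$ with $f$-expansion $(x_i)$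 and $n>m$ let $\tau^f_w(x,n)=\#\{i\in\{1,\dots,n-m\}: x_i\dots x_{i+m-1}=w\}$. For $\bar p=(p_{w_1},\dots,p_{w_{g_f^m}})\in[0,1]^{g_f^m}$ with $\sum_j p_{w_j}=1$, let $G^{f,m}_{\bar p}=\{x: \tau^f_{w_j}(x,n)/(n-m)\to p_{w_j}\text{ as }n\to\infty\ \forall j\}$. Condition (ii): for each $m$ there is $\bar p$ with $\dim_H G^{f,m}_{\bar p}=1$, and for each word $w$ of length $m$ and each $\delta>0$ there is $\bar q$ with $q_w\ne p_w$ and $\dim_H G^{f,m}_{\bar q}>1-\delta$. Normality: $x$ is $m$-normal to $f$ if $\tau^f_w(x,n)/(n-m)\to |C_w|$ as $n\to\infty$ for every word $w$ of length $m$, where $|C_w|$ is the length of the cylinder $C_w$. *)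

(* Defs.v *)
From Stdlib Require Import Reals Lra Lia List Arith.
Import ListNotations.
Open Scope R_scope.

(* H^s(E) = 0, with H^s = lim_{delta->0} H^s_delta, H^s_delta(E) = inf of
   sum_i diam(U_i)^s over countable delta-covers.  A cover is given by sets
   U i together with positive numbers r i bounding their diameters
   (r i >= diam(U i)); this does not change the infimum for s > 0. *)
Definition hausdorff_null (s : R) (E : R -> Prop) : Prop :=
  forall delta eps : R, 0 < delta -> 0 < eps ->
  exists (U : nat -> R -> Prop) (r : nat -> R),
    (forall i, 0 < r i <= delta) /\
    (forall i x y, U i x -> U i y -> Rabs (x - y) <= r i) /\
    (forall x, E x -> exists i, U i x) /\
    (exists l, infinite_sum (fun i => Rpower (r i) s) l /\ l < eps).

Definition is_glb_R (P : R -> Prop) (d : R) : Prop :=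
  (forall s, P s -> d <= s) /\ (forall d', (forall s, P s -> d' <= s) -> d' <= d).

Definition hausdorff_dim (E : R -> Prop) (d : R) : Prop :=
  is_glb_R (fun s => 0 <= s /\ hausdorff_null s E) d.

(* The partition of [0,1) into g intervals [a k, a (k+1)), k = 0..g-1,
   enumerated from left to right. *)
Definition in_interval (a : nat -> R) (k : nat) (y : R) : Prop :=
  a k <= y < a (S k).

Definition unit_int (x : R) : Prop := 0 <= x < 1.

Definition valid_word (g : nat) (w : list nat) : Prop :=
  Forall (fun k => (k < g)%nat) w.

Definition cylinder (f : R -> R) (a : nat -> R) (w : list nat) (x : R) : Prop :=
  unit_int x /\
  forall i, (i < length w)%nat -> in_interval a (nth i w 0%nat) (Nat.iter i f x).

(* |C| = diameter (= length, since cylinders are intervals) *)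
Definition is_length (C : R -> Prop) (L : R) : Prop :=
  is_lub (fun d => exists x y, C x /\ C y /\ d = Rabs (x - y)) L.

Definition derivative_within (F : R -> R) (C : R -> Prop) (D : R -> R) : Prop :=
  forall y, C y -> forall eps, 0 < eps -> exists del, 0 < del /\
    forall x, C x -> x <> y -> Rabs (x - y) < del ->
      Rabs ((F x - F y) / (x - y) - D y) < eps.

Definition admissible_map (f : R -> R) (g : nat) (a : nat -> R) : Prop :=
  (2 <= g)%nat /\
  a 0%nat = 0 /\ a g = 1 /\ (forall k, (k < g)%nat -> a k < a (S k)) /\
  (forall k, (k < g)%nat ->
     ((forall x y, in_interval a k x -> in_interval a k y -> x <= y -> f x <= f y) \/
      (forall x y, in_interval a k x -> in_interval a k y -> x <= y -> f y <= f x)) /\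
     (forall x, in_interval a k x -> unit_int (f x)) /\
     (forall y, unit_int y -> exists x, in_interval a k x /\ f x = y) /\
     (forall x y, in_interval a k x -> in_interval a k y ->
        Rabs (x - y) <= Rabs (f x - f y))) /\
  (forall xs : nat -> nat, (forall i, (xs i < g)%nat) ->
     forall eps, 0 < eps -> exists N, forall n, (N <= n)%nat ->
       forall x y, cylinder f a (map xs (seq 0 n)) x ->
                   cylinder f a (map xs (seq 0 n)) y -> Rabs (x - y) <= eps).

(* Condition (i): bounded distortion (the derivative of f^n within each
   cylinder of generation n exists and the ratio of its absolute values is
   < K; the ratio |D y|/|D z| < K is written as |D y| < K |D z|). *)
Definition cond_i (f : R -> R) (g : nat) (a : nat -> R) : Prop :=
  exists K, 0 < K /\
    forall w, valid_word g w ->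
      exists D, derivative_within (Nat.iter (length w) f) (cylinder f a w) D /\
        forall y z, cylinder f a w y -> cylinder f a w z ->
          Rabs (D y) < K * Rabs (D z).

(* digit of y: the k with y in [a k, a (k+1)) = #{ 1 <= k <= g-1 : a k <= y } *)
Definition digit_of (g : nat) (a : nat -> R) (y : R) : nat :=
  fold_right (fun k acc => if Rle_dec (a k) y then S acc else acc) 0%nat
             (seq 1 (g - 1)).

(* the f-expansion of x, 0-based: x_{i+1} of the paper is expansion i *)
Definition expansion (f : R -> R) (g : nat) (a : nat -> R) (x : R) (i : nat) : nat :=
  digit_of g a (Nat.iter i f x).

Definition tau (f : R -> R) (g : nat) (a : nat -> R) (w : list nat) (x : R) (n : nat) : nat :=
  let m := length w in
  length (filter (fun i =>
      if list_eq_dec Nat.eq_dec (map (fun j => expansion f g a x (i + j)) (seq 0 m)) w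
      then true else false)
    (seq 0 (n - m))).

Definition freq (f : R -> R) (g : nat) (a : nat -> R) (w : list nat) (x : R) (n : nat) : R :=
  INR (tau f g a w x n) / INR (n - length w).

Fixpoint all_words (g m : nat) : list (list nat) :=
  match m with
  | O => [[]]
  | S m' => flat_map (fun k => map (cons k) (all_words g m')) (seq 0 g)
  end.

Definition prob_vector (g m : nat) (p : list nat -> R) : Prop :=
  (forall w, valid_word g w -> length w = m -> 0 <= p w <= 1) /\
  fold_right (fun w acc => p w + acc) 0 (all_words g m) = 1.

Definition freq_set (f : R -> R) (g : nat) (a : nat -> R) (m : nat) (p : list nat -> R)
  (x : R) : Prop :=
  unit_int x /\
  forall w, valid_word g w -> length w = m -> Un_cv (freq f g a w x) (p w).

Definition cond_ii (f : R -> R) (g : nat) (a : nat -> R) : Prop :=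
  forall m, (1 <= m)%nat ->
    exists p, prob_vector g m p /\ hausdorff_dim (freq_set f g a m p) 1 /\
      forall w, valid_word g w -> length w = m ->
        forall delta, 0 < delta ->
          exists q, prob_vector g m q /\ q w <> p w /\
            exists d, hausdorff_dim (freq_set f g a m q) d /\ d > 1 - delta.

Definition m_normal (f : R -> R) (g : nat) (a : nat -> R) (m : nat) (x : R) : Prop :=
  forall w, valid_word g w -> length w = m ->
    exists L, is_length (cylinder f a w) L /\ Un_cv (freq f g a w x) L.

(* Main.v *)
Require Import Defs.
From Stdlib Require Import Reals Lra Lia List Arith Cantor Classical ClassicalEpsilon.
From Coquelicot Require Import Coquelicot.
Import ListNotations.
Open Scope R_scope.

(** Fix 0 < t < 1 and suppose that the set is covered by pieces of size r_i with
    sum r_i^t < 1/8.  Turn the cover into a nondecreasing function Phi with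
    Phi 1 - Phi 0 < 1 such that every covered point lies in a saturated dyadic
    interval, i.e. one on which Phi grows by at least (length)^t.  It then suffices to
    find a point of the set all of whose dyadic intervals are unsaturated.

    Such a point is the limit of a nested sequence of dyadic intervals without
    saturated ancestors.  Halving such an interval J repeatedly, each time keeping the
    half with the smaller increment of Phi, makes the increment on J an arbitrarily small
    multiple of |J|^t, because t < 1.  By bounded distortion J contains a cylinder on
    which some f^n is onto [0,1) and expands by at most kappa/|J|.  The maximal saturated
    subintervals of J are pushed forward by f^n to sets with small sum of t-th powers, so
    these cannot cover a set G of prescribed word frequencies with H^t(G) > 0.  Hence J
    contains a point with these frequencies outside all saturated intervals, and a
    small dyadic interval around it serves as the next one.  Alternating, for all i and
    m, between two different limit frequencies of one word makes the frequencies of the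
    limit point diverge. *)

(** * Hausdorff null sets and countable covers *)

Lemma bounded_nonneg_series (u : nat -> R) (M : R) :
  (forall i, 0 <= u i) -> (forall n, sum_f_R0 u n <= M) ->
  exists l, infinite_sum u l /\ l <= M.
Proof.
  intros Hu HM.
  destruct (ex_finite_lim_seq_incr (sum_f_R0 u) M) as [l Hl]; trivial.
  { intros n; simpl; specialize (Hu (S n)); lra. }
  exists l; split.
  - apply is_lim_seq_Reals in Hl; exact Hl.
  - change (Rbar_le l M).
    apply (is_lim_seq_le (sum_f_R0 u) (fun _ => M)); trivial.
    apply is_lim_seq_const.
Qed.

(* [Rpower 0 t] is 1, hence the separate value at 0. *)
Definition rpow (r t : R) : R := if Rle_dec r 0 then 0 else Rpower r t.

Lemma rpow_nonneg r t : 0 <= rpow r t.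
Proof.
  unfold rpow; destruct Rle_dec; [lra|]. left; apply exp_pos.
Qed.

Lemma rpow_0 t : rpow 0 t = 0.
Proof. unfold rpow; destruct Rle_dec; lra. Qed.

Lemma rpow_pos r t : 0 < r -> rpow r t = Rpower r t.
Proof. unfold rpow; destruct Rle_dec; lra. Qed.

Lemma rpow_mult c r t : 0 < c -> 0 <= r -> rpow (c * r) t = Rpower c t * rpow r t.
Proof.
  intros Hc [Hr | <-].
  - rewrite !rpow_pos by nra. symmetry; now apply Rpower_mult_distr.
  - rewrite Rmult_0_r, rpow_0; ring.
Qed.

Lemma sum_half_powers n : sum_f_R0 (fun i => (/2) ^ i) n = 2 - (/2) ^ n.
Proof.
  induction n as [|n IH]; simpl; [lra|]. rewrite IH; simpl; lra.
Qed.

Lemma term_le_sum (u : nat -> R) n :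
  (forall i, 0 <= u i) -> u n <= sum_f_R0 u n.
Proof.
  intros Hu; destruct n; simpl; [lra|].
  assert (0 <= sum_f_R0 u n) by now apply cond_pos_sum.
  lra.
Qed.

Lemma Rpower_root x t : 0 < t -> 0 < x -> Rpower (Rpower x (/ t)) t = x.
Proof.
  intros Ht Hx. rewrite Rpower_mult, Rinv_l, Rpower_1; lra.
Qed.

Lemma Rpower_le_inv x y t : 0 < t -> 0 < x -> 0 < y -> Rpower x t <= Rpower y t -> x <= y.
Proof.
  intros Ht Hx Hy H. apply Rnot_lt_le; intros Hlt.
  assert (Rpower y t < Rpower x t) by (apply Rlt_Rpower_l; lra). lra.
Qed.

Lemma not_null_uncovered (t : R) (E : R -> Prop) :
  0 < t -> ~ hausdorff_null t E ->
  exists eps, 0 < eps /\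
  forall (U : nat -> R -> Prop) (r : nat -> R),
    (forall i, 0 <= r i) ->
    (forall i x y, U i x -> U i y -> Rabs (x - y) <= r i) ->
    (forall n, sum_f_R0 (fun i => rpow (r i) t) n <= eps) ->
    exists x, E x /\ forall i, ~ U i x.
Proof.
  intros Ht Hn.
  apply not_all_ex_not in Hn as [d Hn]. apply not_all_ex_not in Hn as [e Hn].
  apply imply_to_and in Hn as [Hd Hn]. apply imply_to_and in Hn as [He Hn].
  (* [Rpower d t] forces every single [r i] to be at most [d]; [e / 4] leaves room for the
     substitutes of the zero lengths. *)
  exists (Rmin (e / 4) (Rpower d t)).
  assert (Hdt : 0 < Rpower d t) by apply exp_pos.
  split; [apply Rmin_glb_lt; lra|].
  intros U r Hr HU Hsum.
  apply NNPP; intros Hno; apply Hn.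
  (* Substitutes for lengths 0, with [t]-th powers summing to at most [e / 2]. *)
  pose (rho := fun i => Rmin d (Rpower (e / 4 * (/2) ^ i) (/ t))).
  assert (Hpow : forall i, 0 < (/2)^i) by (intros; apply pow_lt; lra).
  assert (Hrho : forall i, 0 < rho i <= d).
  { intros i; split; [apply Rmin_glb_lt; [lra|apply exp_pos] | apply Rmin_l]. }
  assert (Hrho2 : forall i, Rpower (rho i) t <= e / 4 * (/2) ^ i).
  { intros i. rewrite <- (Rpower_root (e / 4 * (/2) ^ i) t) by (trivial; specialize (Hpow i); nra).
    apply Rle_Rpower_l; [lra|]. split; [apply Hrho|apply Rmin_r]. }
  pose (r' := fun i => if Rle_dec (r i) 0 then rho i else r i).
  exists U, r'. repeat split.
  - unfold r'; destruct Rle_dec; [apply Hrho | lra].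
  - unfold r'; destruct Rle_dec; [apply Hrho | ].
    apply (Rpower_le_inv _ _ t); try lra.
    rewrite <- rpow_pos by lra.
    eapply Rle_trans; [apply (term_le_sum (fun i => rpow (r i) t)); intros; apply rpow_nonneg|].
    eapply Rle_trans; [apply Hsum|apply Rmin_r].
  - intros i x y Hx Hy; unfold r'; destruct Rle_dec; [|auto].
    specialize (HU i x y Hx Hy); specialize (Hrho i); lra.
  - intros x Hx; apply NNPP; intros Hc; apply Hno.
    exists x; split; trivial; intros i Hi; apply Hc; eauto.
  - destruct (bounded_nonneg_series (fun i => Rpower (r' i) t) (3 / 4 * e)) as [l [Hl Hle]].
    + intros; left; apply exp_pos.
    + intros n.
      apply Rle_trans with
        (sum_f_R0 (fun i => rpow (r i) t) n + e / 4 * sum_f_R0 (fun i => (/2)^i) n).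
      * rewrite scal_sum, <- sum_plus. apply sum_Rle; intros i _.
        unfold r'; specialize (Hrho2 i); specialize (Hpow i).
        destruct Rle_dec.
        -- assert (H0 := rpow_nonneg (r i) t); lra.
        -- rewrite rpow_pos by lra. nra.
      * rewrite sum_half_powers. specialize (Hsum n); specialize (Hpow n).
        assert (Hm := Rmin_l (e / 4) (Rpower d t)). nra.
    + exists l; split; trivial; lra.
Qed.

(** The points [z i] are interleaved with the cover as singletons of length 0 at the odd indices,
    where [rpow 0 t = 0] makes them free of cost. *)
Lemma not_null_uncovered_countable (t : R) (E : R -> Prop) (z : nat -> R) :
  0 < t -> ~ hausdorff_null t E ->
  exists eps, 0 < eps /\
  forall (U : nat -> R -> Prop) (r : nat -> R),
    (forall i, 0 <= r i) ->
    (forall i x y, U i x -> U i y -> Rabs (x - y) <= r i) ->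
    (forall n, sum_f_R0 (fun i => rpow (r i) t) n <= eps) ->
    exists x, E x /\ (forall i, ~ U i x) /\ (forall i, x <> z i).
Proof.
  intros Ht Hn. destruct (not_null_uncovered t E Ht Hn) as [e [He H]].
  exists e; split; trivial. intros U r Hr HU Hsum.
  destruct (H (fun n x => if Nat.even n then U (Nat.div2 n) x else x = z (Nat.div2 n))
              (fun n => if Nat.even n then r (Nat.div2 n) else 0)) as [x [Ex Hx]].
  - intros i; destruct (Nat.even i); [auto|lra].
  - intros i x y; destruct (Nat.even i); [auto|].
    intros -> ->. rewrite Rminus_diag, Rabs_R0; lra.
  - set (u := fun i => rpow (if Nat.even i then r (Nat.div2 i) else 0) t).
    assert (Hu : forall i, 0 <= u i) by (intros; apply rpow_nonneg).
    assert (Heq : forall n, sum_f_R0 u (2 * n + 1) = sum_f_R0 (fun i => rpow (r i) t) n).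
    { assert (H1 : forall i, u (2 * i)%nat = rpow (r i) t).
      { intros i; unfold u. rewrite Nat.div2_double.
        now replace (Nat.even (2 * i)) with true by (symmetry; apply Nat.even_spec; exists i; lia). }
      assert (H2 : forall i, u (2 * i + 1)%nat = 0).
      { intros i; unfold u.
        replace (Nat.even (2 * i + 1)) with false; [apply rpow_0|].
        symmetry. rewrite <- Nat.negb_odd. apply Bool.negb_false_iff, Nat.odd_spec. now exists i. }
      induction n as [|n IH].
      - change (u 0%nat + u (2 * 0 + 1)%nat = rpow (r 0%nat) t).
        rewrite H2, <- (H1 0%nat). replace (2 * 0)%nat with 0%nat by lia. ring.
      - replace (2 * S n + 1)%nat with (S (S (2 * n + 1))) by lia.
        rewrite !tech5, IH. replace (S (2 * n + 1)) with (2 * S n)%nat by lia.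
        rewrite H1. replace (S (2 * S n)) with (2 * S n + 1)%nat by lia. rewrite H2; ring. }
    intros n. apply Rle_trans with (sum_f_R0 u (2 * n + 1)).
    + replace (2 * n + 1)%nat with (n + (n + 1))%nat by lia.
      generalize (n + 1)%nat; intros k; induction k as [|k IH].
      * rewrite Nat.add_0_r; lra.
      * rewrite Nat.add_succ_r, tech5. specialize (Hu (S (n + k))). lra.
    + rewrite Heq; apply Hsum.
  - exists x; repeat split; trivial; intros i.
    + specialize (Hx (2 * i)%nat). rewrite Nat.div2_double in Hx.
      now replace (Nat.even (2 * i)) with true in Hx
        by (symmetry; apply Nat.even_spec; exists i; lia).
    + specialize (Hx (2 * i + 1)%nat).
      replace (Nat.even (2 * i + 1)) with false in Hx.
      2:{ symmetry. rewrite <- Nat.negb_odd. apply Bool.negb_false_iff, Nat.odd_spec. now exists i. }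
      replace (2 * i + 1)%nat with (S (2 * i)) in Hx by lia.
      now rewrite Nat.div2_succ_double in Hx.
Qed.

(** With all [r i] capped at 1, raising the exponent only lowers the powers. *)
Lemma hausdorff_null_mono_exponent (s t : R) (E : R -> Prop) :
  s <= t -> hausdorff_null s E -> hausdorff_null t E.
Proof.
  intros Hst H d e Hd He.
  destruct (H (Rmin d 1) e) as [U [r [Hr [HU [Hc [l [Hl Hle]]]]]]]; trivial.
  { apply Rmin_glb_lt; lra. }
  exists U, r.
  assert (Hr1 : forall i, 0 < r i <= 1).
  { intros i; specialize (Hr i); assert (H1 := Rmin_r d 1); lra. }
  split; [intros i; specialize (Hr i); assert (H1 := Rmin_l d 1); lra|].
  repeat split; trivial.
  destruct (bounded_nonneg_series (fun i => Rpower (r i) t) l) as [l' [Hl' Hle']].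
  - intros; left; apply exp_pos.
  - intros n. apply Rle_trans with (sum_f_R0 (fun i => Rpower (r i) s) n).
    + apply sum_Rle; intros i _. unfold Rpower.
      assert (Hln : ln (r i) <= 0).
      { rewrite <- ln_1. apply ln_le; apply Hr1. }
      assert (Hm : t * ln (r i) <= s * ln (r i)) by nra.
      destruct Hm as [Hm | ->]; [left; now apply exp_increasing | lra].
    + apply sum_incr; [exact Hl|]. intros; left; apply exp_pos.
  - exists l'; split; trivial; lra.
Qed.

Lemma sum_const_support (c : R) (u : nat -> R) (N : nat) :
  0 <= c -> (forall i, (i < N)%nat -> u i = c) -> (forall i, (N <= i)%nat -> u i = 0) ->
  forall n, sum_f_R0 u n <= INR N * c.
Proof.
  intros Hc H1 H2 n.
  assert (sum_f_R0 u n <= INR (Nat.min (S n) N) * c).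
  { induction n as [|n IH].
    - simpl sum_f_R0. destruct N as [|N]; [rewrite H2 by lia; simpl; lra|].
      rewrite H1 by lia. simpl Nat.min. replace (Nat.min 0 N) with 0%nat by lia. simpl; lra.
    - rewrite tech5. destruct (le_lt_dec N (S n)) as [h|h].
      + rewrite H2 by lia. replace (Nat.min (S (S n)) N) with (Nat.min (S n) N) by lia. lra.
      + rewrite H1 by lia.
        replace (Nat.min (S (S n)) N) with (S (S n)) by lia.
        replace (Nat.min (S n) N) with (S n) in IH by lia.
        rewrite (S_INR (S n)). lra. }
  eapply Rle_trans; [eassumption|].
  apply Rmult_le_compat_r; trivial. apply le_INR; lia.
Qed.

(** Cutting [0,1) into [N] equal intervals costs [N^(1-s)], which tends to 0. *)
Lemma unit_interval_null (s : R) (E : R -> Prop) :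
  1 < s -> (forall x, E x -> 0 <= x < 1) -> hausdorff_null s E.
Proof.
  intros Hs HE. apply NNPP; intros Hn.
  destruct (not_null_uncovered s E) as [e [He H]]; trivial; try lra.
  (* [N = M + 1] exceeds [(1/e)^(1/(s-1))], which is what [N^(1-s) <= e] requires. *)
  destruct (nfloor_ex (Rpower (/ e) (/ (s - 1)))) as [M [_ HM]].
  { left; apply exp_pos. }
  rewrite <- S_INR in HM. set (N := S M) in *.
  assert (HN : 0 < INR N) by (unfold N; rewrite S_INR; assert (h := pos_INR M); lra).
  assert (HiN : 0 < / INR N) by now apply Rinv_0_lt_compat.
  destruct (H (fun i x => (i < N)%nat /\ INR i <= x * INR N < INR i + 1)
              (fun i => if lt_dec i N then / INR N else 0)) as [x [Ex Hx]].
  - intros i; destruct lt_dec; lra.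
  - intros i x y [Hi Hx] [_ Hy]. destruct lt_dec; [|lia].
    apply Rmult_le_reg_r with (INR N); trivial. rewrite Rinv_l by lra.
    rewrite <- (Rabs_pos_eq (INR N)) at 1 by lra. rewrite <- Rabs_mult.
    apply Rabs_le; lra.
  - intros n.
    apply Rle_trans with (INR N * Rpower (/ INR N) s).
    + apply sum_const_support; [left; apply exp_pos| |]; intros i Hi; destruct lt_dec; try lia.
      * now rewrite rpow_pos.
      * now rewrite rpow_0.
    + assert (h : / e <= Rpower (INR N) (s - 1)).
      { rewrite <- (Rpower_root (/ e) (s - 1)); [|lra|now apply Rinv_0_lt_compat].
        apply Rle_Rpower_l; [lra|]. split; [apply exp_pos|lra]. }
      replace (Rpower (/ INR N) s) with (/ INR N * / Rpower (INR N) (s - 1)).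
      2:{ rewrite <- Rpower_Ropp. unfold Rpower. rewrite ln_Rinv by trivial.
          rewrite <- (exp_ln (/ INR N)) by trivial. rewrite <- exp_plus. f_equal.
          rewrite ln_Rinv by trivial. ring. }
      rewrite <- Rmult_assoc, Rinv_r, Rmult_1_l by lra.
      rewrite <- (Rinv_inv e). apply Rinv_le_contravar; trivial. now apply Rinv_0_lt_compat.
  - assert (Hu := HE x Ex).
    destruct (nfloor_ex (x * INR N)) as [i Hi]; [nra|].
    apply (Hx i); split; trivial.
    apply INR_lt. nra.
Qed.

(** * Dyadic intervals and saturation *)

Definition dyl (n j : nat) : R := INR j / 2 ^ n.

Definition dyadic (n j : nat) (x : R) : Prop := dyl n j <= x < dyl n (S j).

Lemma two_pow_pos n : 0 < 2 ^ n.
Proof. apply pow_lt; lra. Qed.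

Lemma two_pow_inv_pos n : 0 < / 2 ^ n.
Proof. apply Rinv_0_lt_compat, two_pow_pos. Qed.

Lemma dyl_width n j : dyl n (S j) - dyl n j = / 2 ^ n.
Proof. unfold dyl; rewrite S_INR; field. apply Rgt_not_eq, two_pow_pos. Qed.

Lemma dyadic_iff n j x : dyadic n j x <-> INR j <= x * 2 ^ n < INR (S j).
Proof.
  assert (H := two_pow_pos n). unfold dyadic, dyl.
  rewrite Rle_div_l, <- Rlt_div_r by trivial. tauto.
Qed.

Lemma dyadic_exists n x : 0 <= x -> exists j, dyadic n j x.
Proof.
  intros Hx. destruct (nfloor_ex (x * 2 ^ n)) as [j Hj].
  - assert (H := two_pow_pos n); nra.
  - exists j. rewrite dyadic_iff, S_INR; lra.
Qed.

Lemma dyadic_nested n' n j' j x :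
  (n' <= n)%nat -> dyadic n j x -> dyadic n' j' x ->
  dyl n' j' <= dyl n j /\ dyl n (S j) <= dyl n' (S j').
Proof.
  intros Hn H H'. rewrite dyadic_iff in H, H'.
  replace n with (n' + (n - n'))%nat in * by lia. set (k := (n - n')%nat) in *.
  assert (Hk := two_pow_pos k). assert (Hn' := two_pow_pos n').
  rewrite pow_add in H.
  assert (E : 2 ^ k = INR (2 ^ k)) by (rewrite pow_INR; now simpl).
  rewrite E in *.
  (* At scale [n] the endpoints are integers, so the strict inequalities through the common point
     [x] improve to weak ones between endpoints. *)
  assert (H1 : (j' * 2 ^ k <= j)%nat).
  { apply Nat.lt_succ_r, INR_lt. rewrite mult_INR. nra. }
  assert (H2 : (S j <= S j' * 2 ^ k)%nat).
  { apply INR_lt. rewrite mult_INR. nra. }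
  apply le_INR in H1, H2. rewrite mult_INR in H1, H2.
  unfold dyl. rewrite pow_add, E. split.
  - rewrite <- Rle_div_r by nra.
    replace (INR j' / 2 ^ n' * (2 ^ n' * INR (2 ^ k)))
      with (INR j' * INR (2 ^ k)) by (field; lra). lra.
  - rewrite Rle_div_l by nra.
    replace (INR (S j') / 2 ^ n' * (2 ^ n' * INR (2 ^ k)))
      with (INR (S j') * INR (2 ^ k)) by (field; lra). lra.
Qed.

Lemma dyadic_unique n j j' x : dyadic n j x -> dyadic n j' x -> j = j'.
Proof.
  rewrite !dyadic_iff. intros H H'.
  assert (j < S j')%nat by (apply INR_lt; lra).
  assert (j' < S j)%nat by (apply INR_lt; lra). lia.
Qed.

(* Removing the last interval: collapse [Phi] on it to a constant, which keeps [Phi] monotone. *)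
Lemma disjoint_increments N : forall (Phi : R -> R) (lo hi : nat -> R) (u v : R),
  (forall x y, x <= y -> Phi x <= Phi y) ->
  (forall k, (k <= N)%nat -> u <= lo k /\ lo k <= hi k /\ hi k <= v) ->
  (forall k k', (k < k' <= N)%nat -> hi k <= lo k' \/ hi k' <= lo k) ->
  sum_f_R0 (fun k => Phi (hi k) - Phi (lo k)) N <= Phi v - Phi u.
Proof.
  induction N as [|N IH]; intros Phi lo hi u v Hm Hb Hd.
  - simpl. destruct (Hb 0%nat) as [H1 [H2 H3]]; [lia|].
    apply Hm in H1, H3; lra.
  - rewrite tech5.
    set (p := lo (S N)); set (q := hi (S N)).
    destruct (Hb (S N)) as [Hup [Hpq Hqv]]; [lia|]. fold p q in Hup, Hpq, Hqv.
    set (Psi := fun z => Phi z - Phi (Rmax p (Rmin z q))).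
    assert (E1 : forall z, z <= p -> Psi z = Phi z - Phi p).
    { intros z Hz; unfold Psi. rewrite Rmin_left, Rmax_left by lra; lra. }
    assert (E2 : forall z, q <= z -> Psi z = Phi z - Phi q).
    { intros z Hz; unfold Psi. rewrite Rmin_right, Rmax_right by lra; lra. }
    assert (E3 : forall z, p <= z <= q -> Psi z = 0).
    { intros z Hz; unfold Psi. rewrite Rmin_left, Rmax_right by lra; lra. }
    assert (Hmono : forall x y, x <= y -> Psi x <= Psi y).
    { intros x y Hxy. assert (A1 := Hm x y Hxy).
      destruct (Rle_lt_dec x p), (Rle_lt_dec y p), (Rle_lt_dec q x), (Rle_lt_dec q y);
        try lra;
        repeat match goal with
        | |- context [Psi ?z] =>
            first [rewrite (E1 z) by lra | rewrite (E2 z) by lra | rewrite (E3 z) by lra]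
        end;
        assert (B1 : x <= p -> Phi x <= Phi p) by auto;
        assert (B2 : q <= y -> Phi q <= Phi y) by auto;
        assert (B3 := Hm p q Hpq);
        try (specialize (B1 ltac:(lra))); try (specialize (B2 ltac:(lra))); lra. }
    assert (HI := IH Psi lo hi u v Hmono).
    rewrite (E1 u), (E2 v) in HI by lra.
    rewrite (sum_eq _ (fun k => Psi (hi k) - Psi (lo k))).
    + assert (HI' : sum_f_R0 (fun k => Psi (hi k) - Psi (lo k)) N
                    <= Phi v - Phi q - (Phi u - Phi p)).
      { apply HI; intros; [apply Hb | apply Hd]; lia. }
      lra.
    + intros k Hk. destruct (Hb k) as [_ [H2 _]]; [lia|].
      destruct (Hd k (S N)) as [H|H]; [lia| |].
      * fold p in H. rewrite !E1 by lra; lra.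
      * fold q in H. rewrite !E2 by lra; lra.
Qed.

Section Saturation.

Variables (Phi : R -> R) (t : R).
Hypothesis Phi_mono : forall x y, x <= y -> Phi x <= Phi y.
Hypothesis t_range : 0 < t < 1.

Definition mass (n j : nat) : R := Phi (dyl n (S j)) - Phi (dyl n j).

Definition saturated (n j : nat) : Prop := Rpower (/ 2 ^ n) t <= mass n j.

(** Since dyadic intervals with a common point are nested, the common [x] says that [(n', j')] is an
    ancestor of [(n, j)] or [(n, j)] itself. *)
Definition unsaturated_above (n j : nat) : Prop :=
  forall n' j' x, (n' <= n)%nat -> dyadic n j x -> dyadic n' j' x -> ~ saturated n' j'.

Lemma dyadic_left n j : dyadic n j (dyl n j).
Proof.
  assert (H := dyl_width n j). assert (H' := two_pow_inv_pos n). unfold dyadic; lra.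
Qed.

Lemma unsaturated_above_mass n j : unsaturated_above n j -> mass n j < Rpower (/ 2 ^ n) t.
Proof.
  intros H. apply Rnot_le_lt. apply (H n j (dyl n j)); trivial; apply dyadic_left.
Qed.

Lemma child_left n j : dyl (S n) (2 * j) = dyl n j.
Proof.
  unfold dyl. rewrite mult_INR. simpl. field. apply Rgt_not_eq, two_pow_pos.
Qed.

Lemma child_right n j : dyl (S n) (S (S (2 * j))) = dyl n (S j).
Proof.
  unfold dyl. rewrite !S_INR, mult_INR. simpl. field. apply Rgt_not_eq, two_pow_pos.
Qed.

(** This is where [t < 1] enters: [2^(-t) > 1/2], so halving an interval lowers its saturation
    threshold by less than half. *)
Lemma Rpower_half_step n : Rpower (/ 2 ^ n) t / 2 < Rpower (/ 2 ^ S n) t.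
Proof.
  assert (H := two_pow_inv_pos n).
  replace (/ 2 ^ S n) with (/ 2 * / 2 ^ n) by (simpl; field; apply Rgt_not_eq, two_pow_pos).
  rewrite <- Rpower_mult_distr by lra.
  assert (H1 : / 2 < Rpower (/ 2) t).
  { rewrite <- (Rpower_1 (/ 2)) at 1 by lra. unfold Rpower. apply exp_increasing.
    assert (ln (/ 2) < 0) by (rewrite <- ln_1; apply ln_increasing; lra). nra. }
  assert (H2 : 0 < Rpower (/ 2 ^ n) t) by apply exp_pos. nra.
Qed.

(* Passing to the half with less mass divides the mass by 2 but the threshold only by 2^t. *)
Lemma unsaturated_child n j : unsaturated_above n j ->
  exists j', unsaturated_above (S n) j' /\ mass (S n) j' <= mass n j / 2 /\
             dyl n j <= dyl (S n) j' /\ dyl (S n) (S j') <= dyl n (S j).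
Proof.
  intros H.
  assert (Hw1 := dyl_width (S n) (2 * j)). assert (Hw2 := dyl_width (S n) (S (2 * j))).
  assert (Hp := two_pow_inv_pos (S n)).
  assert (Hc : exists j', mass (S n) j' <= mass n j / 2 /\
             dyl n j <= dyl (S n) j' /\ dyl (S n) (S j') <= dyl n (S j)).
  { rewrite <- (child_left n j), <- (child_right n j).
    destruct (Rle_lt_dec (mass (S n) (2 * j)) (mass n j / 2)).
    - exists (2 * j)%nat. repeat split; trivial; lra.
    - exists (S (2 * j)). repeat split; try lra.
      unfold mass in *. rewrite <- (child_left n j), <- (child_right n j) in *. lra. }
  destruct Hc as [j' [Hm [H1 H2]]]. exists j'; repeat split; trivial.
  intros n' j'' x Hn Hx Hx'.
  destruct (Nat.eq_dec n' (S n)) as [->|].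
  - rewrite (dyadic_unique (S n) j'' j' x) by trivial. unfold saturated.
    assert (A1 := unsaturated_above_mass n j H). assert (A2 := Rpower_half_step n). lra.
  - apply (H n' j'' x); try lia; trivial. unfold dyadic in *; lra.
Qed.

(** Each passage to the lighter half multiplies the bound on mass over threshold by [2^(t-1) < 1];
    enough passages bring it below [eta]. *)
Lemma unsaturated_low_mass n j eta : unsaturated_above n j -> 0 < eta ->
  exists n' j', (n <= n')%nat /\ unsaturated_above n' j' /\
    mass n' j' <= eta * Rpower (/ 2 ^ n') t /\
    dyl n j <= dyl n' j' /\ dyl n' (S j') <= dyl n (S j).
Proof.
  intros H He.
  (* [rho = 2^(t-1)]. *)
  set (rho := / 2 / Rpower (/ 2) t).
  assert (Hh : 0 < Rpower (/ 2) t) by apply exp_pos.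
  assert (Hrho : 0 < rho < 1).
  { assert (Hs := Rpower_half_step 0). simpl in Hs.
    replace (Rpower (/ 1) t) with 1 in Hs
      by (unfold Rpower; rewrite Rinv_1, ln_1, Rmult_0_r, exp_0; lra).
    rewrite Rmult_1_r in Hs. unfold rho; split.
    - apply Rdiv_lt_0_compat; lra.
    - rewrite Rlt_div_l by trivial. lra. }
  assert (Hk : forall k, exists j', unsaturated_above (n + k) j' /\
    mass (n + k) j' <= rho ^ k * Rpower (/ 2 ^ (n + k)) t /\
    dyl n j <= dyl (n + k) j' /\ dyl (n + k) (S j') <= dyl n (S j)).
  { induction k as [|k [j' [H1 [H2 [H3 H4]]]]].
    - exists j. rewrite Nat.add_0_r. repeat split; trivial; try lra.
      assert (A := unsaturated_above_mass n j H). simpl; lra.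
    - destruct (unsaturated_child _ _ H1) as [j2 [B1 [B2 [B3 B4]]]].
      rewrite Nat.add_succ_r. exists j2; repeat split; trivial; try lra.
      replace (/ 2 ^ S (n + k)) with (/ 2 * / 2 ^ (n + k))
        by (simpl; field; apply Rgt_not_eq, two_pow_pos).
      rewrite <- Rpower_mult_distr; [| lra | apply two_pow_inv_pos].
      apply Rle_trans with (mass (n + k) j' / 2); trivial.
      simpl. replace (rho * rho ^ k * (Rpower (/ 2) t * Rpower (/ 2 ^ (n + k)) t))
        with (rho * Rpower (/2) t * (rho ^ k * Rpower (/ 2 ^ (n + k)) t)) by ring.
      replace (rho * Rpower (/ 2) t) with (/ 2) by (unfold rho; field; lra). lra. }
  destruct (pow_lt_1_zero rho) with (y := eta) as [k Hkk]; trivial.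
  { rewrite Rabs_pos_eq; lra. }
  specialize (Hkk k (le_n k)). rewrite Rabs_pos_eq in Hkk by (apply pow_le; lra).
  destruct (Hk k) as [j' [H1 [H2 [H3 H4]]]].
  exists (n + k)%nat, j'; repeat split; trivial; try lia.
  assert (0 < Rpower (/ 2 ^ (n + k)) t) by apply exp_pos. nra.
Qed.

(** Only strictly coarser intervals are tested, so these are the outermost saturated ones. They are
    pairwise disjoint and still contain every saturated interval. *)
Definition maximal_saturated (n j : nat) : Prop :=
  saturated n j /\
  forall n' j' x, (n' < n)%nat -> dyadic n j x -> dyadic n' j' x -> ~ saturated n' j'.

Definition inside (n j n' j' : nat) : Prop :=
  dyl n j <= dyl n' j' /\ dyl n' (S j') <= dyl n (S j).

(** [k] is the Cantor code of a generation and a position, which makes the pieces a sequence. A code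
    that is not a piece later yields the empty set and length 0. *)
Definition piece (n j k : nat) : Prop :=
  maximal_saturated (fst (Cantor.of_nat k)) (snd (Cantor.of_nat k)) /\
  inside n j (fst (Cantor.of_nat k)) (snd (Cantor.of_nat k)).

Definition piece_set (n j k : nat) (x : R) : Prop :=
  piece n j k /\ dyadic (fst (Cantor.of_nat k)) (snd (Cantor.of_nat k)) x.

Definition piece_length (n j k : nat) : R :=
  if excluded_middle_informative (piece n j k) then / 2 ^ fst (Cantor.of_nat k) else 0.

Lemma piece_length_nonneg n j k : 0 <= piece_length n j k.
Proof.
  unfold piece_length; destruct excluded_middle_informative; [|lra].
  left; apply two_pow_inv_pos.
Qed.

Lemma piece_set_diam n j k x y :
  piece_set n j k x -> piece_set n j k y -> Rabs (x - y) <= piece_length n j k.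
Proof.
  intros [H Hx] [_ Hy]. unfold piece_length.
  destruct excluded_middle_informative; [|contradiction].
  rewrite <- (dyl_width _ (snd (Cantor.of_nat k))). unfold dyadic in *.
  apply Rabs_le; lra.
Qed.

Lemma maximal_saturated_disjoint n j n' j' x :
  maximal_saturated n j -> maximal_saturated n' j' -> dyadic n j x -> dyadic n' j' x ->
  n = n' /\ j = j'.
Proof.
  intros [H1 H2] [H1' H2'] Hx Hx'.
  destruct (lt_eq_lt_dec n n') as [[Hlt| ->]|Hlt].
  - exfalso; apply (H2' n j x); trivial.
  - split; trivial. eapply dyadic_unique; eauto.
  - exfalso; apply (H2 n' j' x); trivial.
Qed.

(** Saturation bounds the [t]-th power of each piece's length by its mass, and disjoint pieces
    inside [(n, j)] have total mass at most [mass n j]. *)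
Lemma piece_sum n j N :
  sum_f_R0 (fun k => rpow (piece_length n j k) t) N <= mass n j.
Proof.
  (* Codes that are not pieces become the degenerate interval at the left end of [(n, j)]. *)
  set (lo := fun k => if excluded_middle_informative (piece n j k)
     then dyl (fst (Cantor.of_nat k)) (snd (Cantor.of_nat k)) else dyl n j).
  set (hi := fun k => if excluded_middle_informative (piece n j k)
     then dyl (fst (Cantor.of_nat k)) (S (snd (Cantor.of_nat k))) else dyl n j).
  assert (Hnj := dyl_width n j). assert (Hpn := two_pow_inv_pos n).
  apply Rle_trans with (sum_f_R0 (fun k => Phi (hi k) - Phi (lo k)) N).
  - apply sum_Rle; intros k _. unfold piece_length, lo, hi.
    destruct excluded_middle_informative as [[[Hs _] _]|].
    + rewrite rpow_pos by apply two_pow_inv_pos. exact Hs.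
    + rewrite rpow_0; lra.
  - apply disjoint_increments; trivial.
    + intros k _; unfold lo, hi.
      assert (Hw := dyl_width (fst (Cantor.of_nat k)) (snd (Cantor.of_nat k))).
      assert (Hp := two_pow_inv_pos (fst (Cantor.of_nat k))).
      destruct excluded_middle_informative as [[_ [H1 H2]]|]; lra.
    + intros k k' Hkk; unfold lo, hi.
      assert (Hw := dyl_width (fst (Cantor.of_nat k')) (snd (Cantor.of_nat k'))).
      assert (Hp := two_pow_inv_pos (fst (Cantor.of_nat k'))).
      destruct excluded_middle_informative as [[M [H1 H2]]|];
      destruct excluded_middle_informative as [[M' [H1' H2']]|]; try lra.
      (* Overlapping pieces would share the larger of their left endpoints. *)
      apply NNPP; intros Hno. apply not_or_and in Hno as [Ha Hb].
      apply Rnot_le_lt in Ha, Hb.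
      destruct (Cantor.of_nat k) as [p q] eqn:E, (Cantor.of_nat k') as [p' q'] eqn:E'.
      simpl in *.
      assert (Hw' := dyl_width p q). assert (Hp' := two_pow_inv_pos p).
      destruct (maximal_saturated_disjoint p q p' q' (Rmax (dyl p q) (dyl p' q'))) as [-> ->];
        trivial.
      * unfold dyadic; split; [apply Rmax_l|apply Rmax_lub_lt; lra].
      * unfold dyadic; split; [apply Rmax_r|apply Rmax_lub_lt; lra].
      * rewrite <- E' in E. apply Cantor.of_nat_inj in E. lia.
Qed.

(** The coarsest saturated interval around [x] is maximal, and it lies inside [(n, j)] because
    nothing from [(n, j)] upwards is saturated. *)
Lemma saturated_point_in_piece n j x n1 j1 :
  0 <= x -> unsaturated_above n j -> dyadic n j x -> dyadic n1 j1 x -> saturated n1 j1 ->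
  exists k, piece_set n j k x.
Proof.
  intros H0 Hu Hx Hx1 Hs.
  destruct (dec_inh_nat_subset_has_unique_least_element
              (fun m => exists i, dyadic m i x /\ saturated m i)) as [m [[[i [Hi Hsi]] Hmin] _]].
  - intros m; apply classic.
  - exists n1, j1; auto.
  - exists (Cantor.to_nat (m, i)). unfold piece_set, piece.
    rewrite Cantor.cancel_of_to; simpl. repeat split; trivial; try apply Hi.
    + intros n' j' y Hn' Hy Hy' Hs'.
      assert (Hnest := dyadic_nested n' m j' i y ltac:(lia) Hy Hy').
      assert (m <= n')%nat; [|lia].
      apply Hmin. exists j'; split; trivial. unfold dyadic in *; lra.
    + apply (dyadic_nested n m j i x); trivial.
      destruct (le_lt_dec n m); trivial. exfalso.
      apply (Hu m i x); trivial; lia.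
    + apply (dyadic_nested n m j i x); trivial.
      destruct (le_lt_dec n m); trivial. exfalso.
      apply (Hu m i x); trivial; lia.
Qed.

End Saturation.

(** Nested half-open intervals can have empty intersection. The strict decrease of the right ends
    prevents this: the supremum of the left ends is at most [Rt (S k) < Rt k]. *)
Lemma limit_point (L Rt : nat -> R) :
  (forall k, L k < Rt k) -> (forall k, L k <= L (S k)) -> (forall k, Rt (S k) < Rt k) ->
  exists x, forall k, L k <= x < Rt k.
Proof.
  intros H HL HR.
  assert (HLm : forall k i, L k <= L (k + i)%nat).
  { intros k i; induction i as [|i IH]; [rewrite Nat.add_0_r; lra|].
    rewrite Nat.add_succ_r. specialize (HL (k + i)%nat); lra. }
  assert (HRm : forall k i, Rt (k + i)%nat <= Rt k).
  { intros k i; induction i as [|i IH]; [rewrite Nat.add_0_r; lra|].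
    rewrite Nat.add_succ_r. specialize (HR (k + i)%nat); lra. }
  assert (HLR : forall k k', L k <= Rt k').
  { intros k k'. specialize (HLm k k'). specialize (HRm k' k).
    rewrite (Nat.add_comm k' k) in HRm. specialize (H (k + k')%nat). lra. }
  destruct (completeness (fun y => exists k, y = L k)) as [x [Hub Hlub]].
  - exists (Rt 0%nat). intros y [k ->]. apply HLR.
  - exists (L 0%nat), 0%nat; trivial.
  - exists x; intros k; split; [apply Hub; eauto|].
    apply Rle_lt_trans with (Rt (S k)); trivial.
    apply Hlub. intros y [i ->]; apply HLR.
Qed.

(** * Distortion and cylinders *)

(* The two-sided mean value theorem applies to [F] composed with the clamp onto [x, y],
   which is continuous on the whole line. *)
Lemma derivative_within_MVT_lt (F : R -> R) (C : R -> Prop) (D : R -> R) (x y : R) :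
  derivative_within F C D -> (forall z, x <= z <= y -> C z) -> x < y ->
  exists c, C c /\ F y - F x = D c * (y - x).
Proof.
  intros HD HC Hxy.
  set (cl := fun z => Rmax x (Rmin z y)).
  assert (cl_in : forall z, x <= cl z <= y).
  { intros z; unfold cl, Rmax, Rmin; repeat destruct Rle_dec; lra. }
  assert (cl_id : forall z, x <= z <= y -> cl z = z).
  { intros z Hz; unfold cl, Rmax, Rmin; repeat destruct Rle_dec; lra. }
  assert (cl_near : forall z z', x <= z <= y -> Rabs (cl z' - z) <= Rabs (z' - z)).
  { intros z z' Hz; unfold cl, Rmax, Rmin; repeat destruct Rle_dec;
      unfold Rabs; repeat destruct Rcase_abs; lra. }
  destruct (MVT_gen (fun z => F (cl z)) x y D) as [c [Hc E]].
  - rewrite Rmin_left, Rmax_right by lra. intros z Hz.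
    apply is_derive_Reals. intros eps He.
    destruct (HD z (HC z ltac:(lra)) eps He) as [d [Hd H]].
    assert (Hd' : 0 < Rmin d (Rmin (z - x) (y - z))) by (repeat apply Rmin_glb_lt; lra).
    exists (mkposreal _ Hd'). intros h Hh0 Hh. simpl in Hh.
    assert (M1 := Rmin_l d (Rmin (z - x) (y - z))).
    assert (M2 := Rmin_r d (Rmin (z - x) (y - z))).
    assert (M3 := Rmin_l (z - x) (y - z)). assert (M4 := Rmin_r (z - x) (y - z)).
    apply Rabs_def2 in Hh as Hh'. rewrite !cl_id by lra.
    replace h with (z + h - z) at 2 by ring. apply H.
    + apply HC; lra.
    + lra.
    + replace (z + h - z) with h by ring. lra.
  (* Continuity up to the endpoints: close to [z] the difference quotient stays below [|D z| + 1],
     and the clamp does not increase the distance to [z]. *)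
  - rewrite Rmin_left, Rmax_right by lra. intros z Hz eps He.
    destruct (HD z (HC z Hz) 1 ltac:(lra)) as [d [Hd H]].
    assert (Hp : 0 < Rabs (D z) + 1) by (assert (h := Rabs_pos (D z)); lra).
    exists (Rmin d (eps / (Rabs (D z) + 1))). split.
    + apply Rmin_glb_lt; trivial. now apply Rdiv_lt_0_compat.
    + intros z' [_ Hz']. simpl in *. unfold Rdist in *.
      rewrite (cl_id z) by trivial.
      assert (Hn := cl_near z z' Hz).
      assert (M1 := Rmin_l d (eps / (Rabs (D z) + 1))).
      assert (M2 := Rmin_r d (eps / (Rabs (D z) + 1))).
      destruct (Req_dec (cl z') z) as [-> | Hne]; [rewrite Rminus_diag, Rabs_R0; lra|].
      assert (H' := H (cl z') (HC _ (cl_in z')) Hne ltac:(lra)).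
      assert (Hq : Rabs ((F (cl z') - F z) / (cl z' - z)) < Rabs (D z) + 1).
      { replace ((F (cl z') - F z) / (cl z' - z)) with
          (D z + ((F (cl z') - F z) / (cl z' - z) - D z)) by ring.
        eapply Rle_lt_trans; [apply Rabs_triang|]. lra. }
      assert (Hpos : 0 < Rabs (cl z' - z)) by (apply Rabs_pos_lt; lra).
      replace (F (cl z') - F z) with ((F (cl z') - F z) / (cl z' - z) * (cl z' - z))
        by (field; lra).
      rewrite Rabs_mult.
      assert (Hz2 : Rabs (z' - z) < eps / (Rabs (D z) + 1)) by lra.
      apply Rlt_div_r in Hz2; trivial. nra.
  - rewrite Rmin_left, Rmax_right in Hc by lra.
    exists c; split; [now apply HC|].
    now rewrite !cl_id in E by lra.
Qed.

Lemma derivative_within_MVT (F : R -> R) (C : R -> Prop) (D : R -> R) (x y : R) :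
  derivative_within F C D ->
  (forall u v z, C u -> C v -> u <= z <= v -> C z) -> C x -> C y ->
  exists c, C c /\ Rabs (F x - F y) = Rabs (D c) * Rabs (x - y).
Proof.
  intros HD HC Hx Hy.
  destruct (Rtotal_order x y) as [H | [-> | H]].
  - destruct (derivative_within_MVT_lt F C D x y) as [c [Hc E]]; eauto.
    exists c; split; trivial. rewrite <- Rabs_mult. f_equal; lra.
  - exists y; split; trivial. rewrite !Rminus_diag, Rabs_R0; ring.
  - destruct (derivative_within_MVT_lt F C D y x) as [c [Hc E]]; eauto.
    exists c; split; trivial. rewrite <- Rabs_mult. f_equal; lra.
Qed.

Lemma cylinder_cons f a k w x :
  cylinder f a (k :: w) x <-> unit_int x /\ in_interval a k x /\
    (forall i, (i < length w)%nat -> in_interval a (nth i w 0%nat) (Nat.iter i f (f x))).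
Proof.
  unfold cylinder; split.
  - intros [Hu H]; split; [trivial|split].
    + apply (H 0%nat); simpl; lia.
    + intros i Hi. rewrite Nat.iter_swap. apply (H (S i)); simpl; lia.
  - intros [Hu [H0 H]]; split; trivial.
    intros [|i] Hi; [exact H0|]. simpl. rewrite <- Nat.iter_swap. apply H. simpl in Hi; lia.
Qed.

(** * Branches, cylinders and itineraries of one map *)

Section Map.

Variables (f : R -> R) (g : nat) (a : nat -> R).
Hypothesis Hadm : admissible_map f g a.

Lemma endpoints_mono k k' : (k <= k' <= g)%nat -> a k <= a k'.
Proof.
  destruct Hadm as [_ [_ [_ [H _]]]].
  intros [Hk Hk']; induction Hk as [|k' Hk IH]; [lra|].
  specialize (H k'). specialize (IH ltac:(lia)). specialize (H ltac:(lia)). lra.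
Qed.

Lemma interval_unit k x : (k < g)%nat -> in_interval a k x -> unit_int x.
Proof.
  intros Hk Hx. destruct Hadm as [_ [H0 [H1 _]]]. unfold unit_int, in_interval in *.
  assert (h1 := endpoints_mono 0 k). assert (h2 := endpoints_mono (S k) g).
  specialize (h1 ltac:(lia)). specialize (h2 ltac:(lia)). lra.
Qed.

Lemma interval_exists x : unit_int x -> exists k, (k < g)%nat /\ in_interval a k x.
Proof.
  intros [Hx0 Hx1]. destruct Hadm as [_ [H0 [H1 _]]].
  assert (H : forall n, a 0%nat <= x < a n -> exists k, (k < n)%nat /\ in_interval a k x).
  { induction n as [|n IH]; intros Hn; [lra|].
    destruct (Rlt_le_dec x (a n)) as [h|h].
    - destruct IH as [k [Hk Hk']]; [lra|]. exists k; split; trivial; lia.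
    - exists n; split; [lia|]. split; lra. }
  apply H; lra.
Qed.

(* A decreasing branch would attain its maximum f (a k) < 1, so it would not be onto [0,1). *)
Lemma branch_nondecreasing k x y :
  (k < g)%nat -> in_interval a k x -> in_interval a k y -> x <= y -> f x <= f y.
Proof.
  intros Hk. destruct Hadm as [_ [_ [_ [Ha [H _]]]]].
  destruct (H k Hk) as [[Hm | Hm] [Hu [Ho _]]]; [now apply Hm|].
  exfalso. specialize (Ha k Hk).
  assert (Hak : in_interval a k (a k)) by (unfold in_interval; lra).
  assert (Hfa := Hu _ Hak). unfold unit_int in Hfa.
  destruct (Ho ((f (a k) + 1) / 2)) as [x' [Hx' E]]; [unfold unit_int; lra|].
  assert (f x' <= f (a k)); [|lra].
  apply Hm; trivial. unfold in_interval in *; lra.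
Qed.

Lemma branch_expanding k x y :
  (k < g)%nat -> in_interval a k x -> in_interval a k y -> Rabs (x - y) <= Rabs (f x - f y).
Proof.
  intros Hk. destruct Hadm as [_ [_ [_ [Ha [H _]]]]]. now apply H.
Qed.

Lemma map_unit x : unit_int x -> unit_int (f x).
Proof.
  intros Hx. destruct (interval_exists x Hx) as [k [Hk Hkx]].
  destruct Hadm as [_ [_ [_ [_ [H _]]]]]. now apply (H k Hk).
Qed.

Lemma iter_unit n x : unit_int x -> unit_int (Nat.iter n f x).
Proof. intros Hx; induction n; simpl; trivial; now apply map_unit. Qed.

Lemma branch_onto k y : (k < g)%nat -> unit_int y -> exists x, in_interval a k x /\ f x = y.
Proof. intros Hk. destruct Hadm as [_ [_ [_ [_ [H _]]]]]. now apply (H k Hk). Qed.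

Lemma endpoint_in_interval k : (k < g)%nat -> in_interval a k (a k).
Proof.
  intros Hk. destruct Hadm as [_ [_ [_ [Ha _]]]]. specialize (Ha k Hk). unfold in_interval; lra.
Qed.

(** A nondecreasing branch onto [0,1) takes its minimum 0 at its left endpoint. *)
Lemma map_endpoint k : (k < g)%nat -> f (a k) = 0.
Proof.
  intros Hk. assert (Hak := endpoint_in_interval k Hk).
  destruct (branch_onto k 0 Hk) as [x [Hx E]]; [unfold unit_int; lra|].
  assert (f (a k) <= f x).
  { apply (branch_nondecreasing k); trivial. unfold in_interval in *; lra. }
  assert (unit_int (f (a k))) by now apply map_unit, (interval_unit k).
  unfold unit_int in *; lra.
Qed.

Lemma map_zero : f 0 = 0.
Proof.
  assert (H := map_endpoint 0). destruct Hadm as [Hg [H0 _]]. rewrite H0 in H. apply H; lia.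
Qed.

Lemma expansion_same_interval k x y :
  (k < g)%nat -> in_interval a k x -> in_interval a k y -> digit_of g a x = digit_of g a y.
Proof.
  intros Hk Hx Hy. unfold digit_of.
  assert (Hs : forall j, In j (seq 1 (g - 1)) -> (1 <= j < g)%nat)
    by (intros j Hj; apply in_seq in Hj; lia).
  induction (seq 1 (g - 1)) as [|j l IH]; trivial. simpl.
  rewrite IH by (intros; apply Hs; now right).
  specialize (Hs j (or_introl eq_refl)).
  assert (h : a j <= a k \/ a (S k) <= a j).
  { destruct (le_lt_dec j k); [left|right]; apply endpoints_mono; lia. }
  unfold in_interval in *. repeat destruct Rle_dec; trivial; lra.
Qed.

Lemma cylinder_cons_map k w x :
  unit_int x -> cylinder f a (k :: w) x <-> in_interval a k x /\ cylinder f a w (f x).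
Proof.
  intros Hx. rewrite cylinder_cons. unfold cylinder.
  assert (h := map_unit x Hx). tauto.
Qed.

(** Points between two points of one branch interval stay there, and their images stay in order
    because every branch is nondecreasing. Convexity is what the mean value theorem requires of a
    cylinder. *)
Lemma cylinder_convex w u v z : valid_word g w ->
  cylinder f a w u -> cylinder f a w v -> u <= z <= v -> cylinder f a w z.
Proof.
  intros Hw; revert u v z; induction Hw as [|k w Hk Hw IH]; intros u v z Hu Hv Hz.
  - split; [|simpl; lia]. destruct Hu as [Hu _], Hv as [Hv _]. unfold unit_int in *; lra.
  - assert (Uu := proj1 Hu). assert (Uv := proj1 Hv).
    assert (Uz : unit_int z) by (unfold unit_int in *; lra).
    rewrite cylinder_cons_map in Hu, Hv by trivial.
    destruct Hu as [Hu1 Hu2], Hv as [Hv1 Hv2].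
    assert (Iz : in_interval a k z) by (unfold in_interval in *; lra).
    apply cylinder_cons_map; trivial. split; trivial.
    apply (IH (f u) (f v)); trivial.
    split; apply (branch_nondecreasing k); trivial; lra.
Qed.

Lemma cylinder_onto w y : valid_word g w -> unit_int y ->
  exists x, cylinder f a w x /\ Nat.iter (length w) f x = y.
Proof.
  intros Hw Hy. induction Hw as [|k w Hk Hw IH].
  - exists y; split; trivial. split; trivial; simpl; lia.
  - destruct IH as [x [Hx E]].
    destruct (branch_onto k x Hk (proj1 Hx)) as [x' [Hx' E']].
    exists x'; split.
    + apply cylinder_cons_map; [now apply (interval_unit k)|]. now rewrite E'.
    + simpl. rewrite <- Nat.iter_swap, E'. exact E.
Qed.

Lemma itinerary_exists x : unit_int x ->
  exists xs : nat -> nat, (forall i, (xs i < g)%nat) /\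
    (forall i, in_interval a (xs i) (Nat.iter i f x)).
Proof.
  intros Hx.
  assert (H : forall i, exists k, (k < g)%nat /\ in_interval a k (Nat.iter i f x))
    by (intros i; now apply interval_exists, iter_unit).
  exists (fun i => proj1_sig (constructive_indefinite_description _ (H i))).
  split; intros i; destruct constructive_indefinite_description; simpl; tauto.
Qed.

Lemma itinerary_cylinder x xs n :
  unit_int x -> (forall i, in_interval a (xs i) (Nat.iter i f x)) ->
  cylinder f a (map xs (seq 0 n)) x.
Proof.
  intros Hx H; split; trivial. intros i Hi. rewrite length_map, length_seq in Hi.
  rewrite (nth_indep _ 0%nat (xs 0%nat)) by now rewrite length_map, length_seq.
  rewrite map_nth, seq_nth by trivial. apply H.
Qed.

(** * Expansion bounds from bounded distortion *)

Section Distortion.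

Variable K : R.
Hypothesis K_pos : 0 < K.
Hypothesis distortion : forall w, valid_word g w ->
  exists D, derivative_within (Nat.iter (length w) f) (cylinder f a w) D /\
    forall y z, cylinder f a w y -> cylinder f a w z -> Rabs (D y) < K * Rabs (D z).

(** By the mean value theorem for both pairs, the slopes differ by a factor at most [K], and
    [|F x' - F y'| <= 1]. Any pair of cylinder points at known distance thus bounds the expansion of
    [F]; the product form allows [x' = y']. *)
Lemma distortion_ratio w x y x' y' :
  valid_word g w ->
  cylinder f a w x -> cylinder f a w y -> cylinder f a w x' -> cylinder f a w y' ->
  let F := Nat.iter (length w) f in
  Rabs (F x - F y) * Rabs (x' - y') <= K * Rabs (x - y).
Proof.
  intros Hw Hx Hy Hx' Hy' F.
  destruct (distortion w Hw) as [D [HD HK]].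
  destruct (derivative_within_MVT F (cylinder f a w) D x y) as [c [Hc E]]; trivial.
  { intros; now apply (cylinder_convex w u v). }
  destruct (derivative_within_MVT F (cylinder f a w) D x' y') as [c' [Hc' E']]; trivial.
  { intros; now apply (cylinder_convex w u v). }
  assert (H1 : Rabs (F x' - F y') <= 1).
  { assert (A := iter_unit (length w) x' (proj1 Hx')).
    assert (B := iter_unit (length w) y' (proj1 Hy')).
    fold F in A, B. unfold unit_int in *. apply Rabs_le; lra. }
  rewrite E. specialize (HK c c' Hc Hc').
  assert (P1 := Rabs_pos (x - y)). assert (P2 := Rabs_pos (x' - y')).
  apply Rle_trans with (K * Rabs (F x' - F y') * Rabs (x - y)); [rewrite E'|].
  - replace (Rabs (D c) * Rabs (x - y) * Rabs (x' - y')) with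
      (Rabs (D c) * (Rabs (x - y) * Rabs (x' - y'))) by ring.
    replace (K * (Rabs (D c') * Rabs (x' - y')) * Rabs (x - y)) with
      (K * Rabs (D c') * (Rabs (x - y) * Rabs (x' - y'))) by ring.
    apply Rmult_le_compat_r; [nra|lra].
  - apply Rmult_le_compat_r; trivial. nra.
Qed.

Lemma uniform_bound (P : nat -> R -> Prop) n :
  (forall k L L', P k L -> L <= L' -> P k L') ->
  (forall k, (k < n)%nat -> exists L, P k L) ->
  exists L, 1 <= L /\ forall k, (k < n)%nat -> P k L.
Proof.
  intros Hmono; induction n as [|n IH]; intros H.
  - exists 1; split; [lra|]. intros; lia.
  - destruct IH as [L [HL HP]]; [intros; apply H; lia|].
    destruct (H n) as [L' HL']; [lia|].
    assert (M1 := Rmax_l L L'). assert (M2 := Rmax_r L L').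
    exists (Rmax L L'); split; [lra|]. intros k Hk.
    destruct (Nat.eq_dec k n) as [->|]; [|assert (Hk' : (k < n)%nat) by lia]; eauto.
Qed.

Lemma branch_lipschitz : exists L, 1 <= L /\ forall k x y, (k < g)%nat ->
  in_interval a k x -> in_interval a k y -> Rabs (f x - f y) <= L * Rabs (x - y).
Proof.
  destruct (uniform_bound (fun k L => forall x y, in_interval a k x -> in_interval a k y ->
     Rabs (f x - f y) <= L * Rabs (x - y)) g) as [L [H1 HL]].
  - intros k L L' H HLL x y Hx Hy. specialize (H x y Hx Hy).
    assert (P := Rabs_pos (x - y)). nra.
  - intros k Hk.
    assert (Ha : a k < a (S k)) by (destruct Hadm as [_ [_ [_ [Ha _]]]]; auto).
    exists (K / ((a (S k) - a k) / 2)). intros x y Hx Hy.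
    (* The reference pair is the left endpoint and the midpoint, as the right endpoint is outside
       the interval. *)
    set (m := (a k + a (S k)) / 2).
    assert (HC : forall z, in_interval a k z -> cylinder f a [k] z).
    { intros z Hz; split; [now apply (interval_unit k)|].
      intros [|i] Hi; simpl in *; [trivial|lia]. }
    assert (H := distortion_ratio [k] x y m (a k)).
    simpl in H. rewrite (Rabs_pos_eq (m - a k)) in H by (unfold m; lra).
    replace (K / ((a (S k) - a k) / 2) * Rabs (x - y)) with
      (K * Rabs (x - y) / ((a (S k) - a k) / 2)) by (field; lra).
    apply Rle_div_r; [lra|].
    replace ((a (S k) - a k) / 2) with (m - a k) by (unfold m; field).
    apply H; try (apply HC; unfold in_interval, m in *; lra).
    repeat constructor; trivial.
  - exists L; split; trivial. intros k x y Hk; now apply HL.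
Qed.

(* The cylinder is the largest one around the midpoint of [u, v) that fits into [u, v);
   its parent contains a point at distance at least (v-u)/2 from the midpoint. *)
Lemma zoom : exists kappa, 0 < kappa /\ forall u v, 0 <= u -> u < v -> v <= 1 ->
  exists w, valid_word g w /\ (forall x, cylinder f a w x -> u <= x < v) /\
    forall x y, cylinder f a w x -> cylinder f a w y ->
      Rabs (Nat.iter (length w) f x - Nat.iter (length w) f y) <= kappa / (v - u) * Rabs (x - y).
Proof.
  destruct branch_lipschitz as [L [HL1 HL]].
  (* The 1 serves the empty word, where the iterate is the identity and [v - u <= 1]. Otherwise the
     parent cylinder expands by at most [2 K / (v - u)] and the last application of [f] by at most
     [L]. *)
  exists (Rmax 1 (2 * L * K)). assert (M1 := Rmax_l 1 (2 * L * K)).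
  assert (M2 := Rmax_r 1 (2 * L * K)).
  split; [lra|]. intros u v Hu Huv Hv.
  set (c := (u + v) / 2).
  assert (Uc : unit_int c) by (unfold unit_int, c; lra).
  destruct (itinerary_exists c Uc) as [xs [Hxs Hin]].
  set (C := fun n => cylinder f a (map xs (seq 0 n))).
  assert (Hval : forall n, valid_word g (map xs (seq 0 n))).
  { intros n; apply Forall_forall. intros k Hk. apply in_map_iff in Hk as [i [<- _]]; auto. }
  assert (Hc : forall n, C n c) by (intros; now apply itinerary_cylinder).
  destruct (dec_inh_nat_subset_has_unique_least_element
    (fun n => forall x, C n x -> Rabs (x - c) < (v - u) / 2)) as [n [[Hn Hmin] _]].
  - intros; apply classic.
  - destruct Hadm as [_ [_ [_ [_ [_ Hsh]]]]].
    destruct (Hsh xs Hxs ((v - u) / 4)) as [N HN]; [lra|].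
    exists N. intros x Hx. specialize (HN N (le_n _) x c Hx (Hc N)). lra.
  - exists (map xs (seq 0 n)); split; [trivial|split].
    + intros x Hx. specialize (Hn x Hx). apply Rabs_def2 in Hn. unfold c in Hn; lra.
    + rewrite length_map, length_seq.
      intros x y Hx Hy. assert (P := Rabs_pos (x - y)).
      destruct n as [|n].
      * simpl. assert (1 <= Rmax 1 (2 * L * K) / (v - u)); [|nra].
        apply Rle_div_r; lra.
      * assert (Hnot : ~ forall z, C n z -> Rabs (z - c) < (v - u) / 2).
        { intros H. apply Hmin in H. lia. }
        apply not_all_ex_not in Hnot as [z Hz]. apply imply_to_and in Hz as [Hz Hzc].
        apply Rnot_lt_le in Hzc.
        assert (Hsub : forall z, cylinder f a (map xs (seq 0 (S n))) z ->
          C n z /\ in_interval a (xs n) (Nat.iter n f z)).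
        { intros z' [Uz' Hz']. rewrite length_map, length_seq in Hz'.
          assert (Hi : forall i, (i < S n)%nat -> in_interval a (xs i) (Nat.iter i f z')).
          { intros i Hi. specialize (Hz' i Hi).
            rewrite (nth_indep _ 0%nat (xs 0%nat)) in Hz' by now rewrite length_map, length_seq.
            now rewrite map_nth, seq_nth in Hz' by trivial. }
          split; [|apply Hi; lia]. split; trivial.
          intros i Hi'. rewrite length_map, length_seq in Hi'.
          rewrite (nth_indep _ 0%nat (xs 0%nat)) by now rewrite length_map, length_seq.
          rewrite map_nth, seq_nth by trivial. apply Hi; lia. }
        destruct (Hsub x Hx) as [Cx Ix], (Hsub y Hy) as [Cy Iy].
        assert (HD := distortion_ratio _ x y z c (Hval n) Cx Cy Hz (Hc n)).
        cbv zeta in HD. rewrite length_map, length_seq in HD.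
        specialize (HL (xs n) _ _ (Hxs n) Ix Iy). simpl.
        set (dF := Rabs (Nat.iter n f x - Nat.iter n f y)) in *.
        assert (PF : 0 <= dF) by apply Rabs_pos.
        eapply Rle_trans; [exact HL|].
        replace (Rmax 1 (2 * L * K) / (v - u) * Rabs (x - y)) with
          (Rmax 1 (2 * L * K) * Rabs (x - y) / (v - u)) by (field; lra).
        apply (Rle_div_r (L * dF) _ (v - u)); [lra|].
        apply Rle_trans with (2 * L * K * Rabs (x - y)); [|nra].
        assert (dF * ((v - u) / 2) <= K * Rabs (x - y)) by nra.
        nra.
Qed.

(** These are the left endpoints of cylinders, where initial digits may fail to be constant
    nearby. *)
Definition zero_orbit (x : R) : Prop := exists n, Nat.iter n f x = 0.

Lemma iter_zero n : Nat.iter n f 0 = 0.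
Proof. induction n as [|n IH]; simpl; [trivial|]. rewrite IH; apply map_zero. Qed.

Lemma zero_orbit_iter n x : zero_orbit x -> zero_orbit (Nat.iter n f x).
Proof.
  intros [m Hm]. exists m. rewrite <- Nat.iter_add, Nat.add_comm, Nat.iter_add, Hm. apply iter_zero.
Qed.

(** Expanding branches are injective, so a preimage of 0 is determined by its finite list of
    branches. *)
Lemma zero_orbit_countable :
  exists z : nat -> R, forall x, unit_int x -> zero_orbit x -> exists i, x = z i.
Proof.
  (* [h k] inverts branch [k]; in [pre], the index codes the branch to apply and the index of the
     point one level lower. *)
  set (h := fun k y => epsilon (inhabits 0) (fun x => in_interval a k x /\ f x = y)).
  set (pre := fix pre n i := match n with
    | O => 0
    | S n => h (fst (Cantor.of_nat i)) (pre n (snd (Cantor.of_nat i)))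
    end).
  assert (H : forall n x, unit_int x -> Nat.iter n f x = 0 -> exists i, x = pre n i).
  { induction n as [|n IH]; intros x Hx E; [now exists 0%nat|].
    destruct (IH (f x)) as [i Hi]; [now apply map_unit|now rewrite Nat.iter_swap|].
    destruct (interval_exists x Hx) as [k [Hk Ik]].
    exists (Cantor.to_nat (k, i)). cbn [pre]. rewrite Cantor.cancel_of_to. simpl fst; simpl snd.
    rewrite <- Hi. unfold h.
    destruct (epsilon_spec (inhabits 0) (fun x' => in_interval a k x' /\ f x' = f x)) as [I1 E1].
    { now exists x. }
    set (x' := epsilon _ _) in *.
    assert (B := branch_expanding k x x' Hk Ik I1). rewrite E1, Rminus_diag, Rabs_R0 in B.
    assert (B' : Rabs (x - x') = 0) by (assert (Q := Rabs_pos (x - x')); lra).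
    apply Rabs_eq_0 in B'. lra. }
  exists (fun i => pre (fst (Cantor.of_nat i)) (snd (Cantor.of_nat i))).
  intros x Hx [n Hn]. destruct (H n x Hx Hn) as [i Hi].
  exists (Cantor.to_nat (n, i)). now rewrite Cantor.cancel_of_to.
Qed.

Lemma expansion_shift x i : expansion f g a x (S i) = expansion f g a (f x) i.
Proof. unfold expansion. now rewrite Nat.iter_swap. Qed.

(** Off the preimages of 0 a point is interior to its branch interval, and the Lipschitz bound
    carries a small neighbourhood into the one obtained for [f x]. *)
Lemma expansion_locally_constant n : forall x, unit_int x -> ~ zero_orbit x ->
  exists d, 0 < d /\ forall y, Rabs (y - x) < d ->
    unit_int y /\ forall i, (i < n)%nat -> expansion f g a y i = expansion f g a x i.
Proof.
  destruct branch_lipschitz as [L [HL1 HL]].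
  induction n as [|n IH]; intros x Hx Hz.
  - assert (Hx0 : x <> 0) by (intros ->; apply Hz; now exists 0%nat).
    unfold unit_int in Hx. exists (Rmin x (1 - x)). split; [apply Rmin_glb_lt; lra|].
    intros y Hy. assert (M1 := Rmin_l x (1 - x)). assert (M2 := Rmin_r x (1 - x)).
    apply Rabs_def2 in Hy. split; [unfold unit_int; lra|intros; lia].
  - destruct (interval_exists x Hx) as [k [Hk Ik]].
    destruct (IH (f x)) as [d [Hd H]]; [now apply map_unit| |].
    { intros [m Hm]. apply Hz. exists (S m). simpl. now rewrite <- Nat.iter_swap. }
    (* Equality would give [f x = 0]. *)
    assert (Hak : a k < x).
    { destruct (proj1 Ik) as [|E]; trivial. exfalso; apply Hz. exists 1%nat.
      simpl. rewrite <- E. now apply map_endpoint. }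
    assert (Hx' := proj2 Ik).
    set (d' := Rmin (d / L) (Rmin (x - a k) (a (S k) - x))).
    assert (M1 := Rmin_l (d / L) (Rmin (x - a k) (a (S k) - x))).
    assert (M2 := Rmin_r (d / L) (Rmin (x - a k) (a (S k) - x))).
    assert (M3 := Rmin_l (x - a k) (a (S k) - x)). assert (M4 := Rmin_r (x - a k) (a (S k) - x)).
    fold d' in M1, M2.
    exists d'. split.
    { repeat apply Rmin_glb_lt; try lra. apply Rdiv_lt_0_compat; lra. }
    intros y Hy. assert (Hy' := Rabs_def2 _ _ Hy).
    assert (Iy : in_interval a k y) by (unfold in_interval; lra).
    split; [now apply (interval_unit k)|].
    intros [|i] Hi.
    + unfold expansion; simpl. now apply (expansion_same_interval k).
    + rewrite !expansion_shift. apply H; [|lia].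
      eapply Rle_lt_trans; [now apply (HL k)|].
      assert (Hd' : Rabs (y - x) < d / L) by lra.
      apply Rlt_div_r in Hd'; lra.
Qed.

End Distortion.

(** * Word frequencies along orbits *)

Lemma freq_ext w x y n :
  (forall i, (i < n)%nat -> expansion f g a x i = expansion f g a y i) ->
  freq f g a w x n = freq f g a w y n.
Proof.
  intros H. unfold freq, tau. do 3 f_equal. apply filter_ext_in.
  intros i Hi. apply in_seq in Hi.
  replace (map (fun j => expansion f g a x (i + j)) (seq 0 (length w)))
    with (map (fun j => expansion f g a y (i + j)) (seq 0 (length w))); trivial.
  apply map_ext_in. intros j Hj. apply in_seq in Hj. symmetry; apply H; lia.
Qed.

Lemma tau_le w x n : (tau f g a w x n <= n - length w)%nat.
Proof.
  unfold tau. eapply Nat.le_trans; [apply filter_length_le|]. now rewrite length_seq.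
Qed.

(** [b] records whether [w] occurs at position 0; the other windows of [x] are those of [f x]. *)
Lemma tau_shift w x n : (length w <= n)%nat ->
  exists b, (b <= 1)%nat /\ tau f g a w x (S n) = (b + tau f g a w (f x) n)%nat.
Proof.
  intros Hn. unfold tau. replace (S n - length w)%nat with (S (n - length w)) by lia.
  cbn [seq filter]. rewrite <- seq_shift.
  set (P := fun x i => if list_eq_dec Nat.eq_dec
    (map (fun j => expansion f g a x (i + j)) (seq 0 (length w))) w then true else false).
  assert (E : length (filter (P x) (map S (seq 0 (n - length w)))) =
              length (filter (P (f x)) (seq 0 (n - length w)))).
  { induction (seq 0 (n - length w)) as [|i l IH]; trivial. cbn [map filter].
    assert (EP : P x (S i) = P (f x) i).
    { unfold P. erewrite map_ext; [reflexivity|].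
      intros j. rewrite Nat.add_succ_l. apply expansion_shift. }
    rewrite EP. destruct (P (f x) i); simpl; now rewrite IH. }
  fold (P x 0%nat). fold (P x). fold (P (f x)).
  destruct (P x 0%nat); [exists 1%nat|exists 0%nat]; (split; [lia|]).
  - cbn [length]. now rewrite E.
  - now rewrite E.
Qed.

Lemma freq_cv_shift w x l : Un_cv (freq f g a w (f x)) l -> Un_cv (freq f g a w x) l.
Proof.
  intros H e He.
  destruct (H (e / 2)) as [N HN]; [lra|].
  (* With [q] windows the extra one changes the frequency by at most [1 / (q + 1)], so [q > 2 / e]
     keeps the change below [e / 2]. *)
  destruct (nfloor_ex (2 / e)) as [M [_ HM]].
  { apply Rlt_le, Rdiv_lt_0_compat; lra. }
  exists (S (N + length w + S M)). intros n Hn. destruct n as [|n]; [lia|].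
  specialize (HN n ltac:(lia)).
  destruct (tau_shift w x n) as [b [Hb E]]; [lia|].
  unfold freq, Rdist in *. rewrite E.
  assert (HT := tau_le w (f x) n).
  set (T := tau f g a w (f x) n) in *.
  replace (S n - length w)%nat with (S (n - length w)) by lia.
  assert (HMl : (S M <= n - length w)%nat) by lia.
  set (q := (n - length w)%nat) in *.
  apply le_INR in HMl, HT, Hb. rewrite S_INR in HMl. rewrite plus_INR, S_INR.
  simpl in Hb. assert (P0 := pos_INR b). assert (P1 := pos_INR T). assert (P2 := pos_INR M).
  assert (Hq : 2 / e < INR q) by lra.
  assert (Hqe : 2 < INR q * e) by (apply Rlt_div_l in Hq; lra).
  assert (Hd : Rabs ((INR b + INR T) / (INR q + 1) - INR T / INR q) <= e / 2).
  { replace ((INR b + INR T) / (INR q + 1) - INR T / INR q) with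
      ((INR b - INR T / INR q) / (INR q + 1)) by (field; lra).
    assert (Hr : 0 <= INR T / INR q <= 1).
    { split; [apply Rdiv_le_0_compat; lra | apply Rle_div_l; lra]. }
    rewrite Rabs_div by lra. rewrite (Rabs_pos_eq (INR q + 1)) by lra.
    apply Rle_div_l; [lra|].
    apply Rle_trans with 1; [apply Rabs_le; lra|nra]. }
  replace ((INR b + INR T) / (INR q + 1) - l) with
    ((INR b + INR T) / (INR q + 1) - INR T / INR q + (INR T / INR q - l)) by ring.
  eapply Rle_lt_trans; [apply Rabs_triang|]. lra.
Qed.

Lemma freq_cv_iter w n x l :
  Un_cv (freq f g a w (Nat.iter n f x)) l -> Un_cv (freq f g a w x) l.
Proof.
  induction n as [|n IH]; simpl; trivial. intros H. apply IH, freq_cv_shift, H.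
Qed.

End Map.

(** * Construction of the limit point *)

Lemma exists_small_dyadic_scale d : 0 < d -> exists n, forall n', (n <= n')%nat -> / 2 ^ n' < d.
Proof.
  intros Hd. destruct (pow_lt_1_zero (/ 2)) with (y := d) as [n Hn]; trivial.
  { rewrite Rabs_pos_eq; lra. }
  exists n; intros n' Hn'. specialize (Hn n' Hn').
  rewrite <- pow_inv. rewrite Rabs_pos_eq in Hn; trivial. apply pow_le; lra.
Qed.

(* Each cover element U_i near c_i is spread out as the density 2 r_i^(t-1) on
   [c_i - 2 r_i, c_i + 2 r_i], of total mass 8 r_i^t; Phi is the distribution function. *)
Lemma cover_potential (t : R) (U : nat -> R -> Prop) (r : nat -> R) (l : R) :
  0 < t < 1 ->
  (forall i, 0 < r i <= 1) ->
  (forall i x y, U i x -> U i y -> Rabs (x - y) <= r i) ->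
  infinite_sum (fun i => Rpower (r i) t) l -> l < / 8 ->
  exists Phi : R -> R,
    (forall x y, x <= y -> Phi x <= Phi y) /\ Phi 1 - Phi 0 < 1 /\
    forall i x, U i x -> 0 <= x -> exists n j, dyadic n j x /\ saturated Phi t n j.
Proof.
  intros Ht Hr HU Hl Hl8.
  (* A point of [U i] when there is one, arbitrary otherwise. *)
  set (c := fun i => epsilon (inhabits 0) (U i)).
  set (clamp := fun i z => Rmax (c i - 2 * r i) (Rmin z (c i + 2 * r i))).
  assert (Hcl : forall i x y, x <= y -> 0 <= clamp i y - clamp i x).
  { intros i x y Hxy. unfold clamp, Rmax, Rmin. specialize (Hr i).
    repeat destruct Rle_dec; lra. }
  assert (Hcl4 : forall i x y, Rabs (clamp i y - clamp i x) <= 4 * r i).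
  { intros i x y. unfold clamp, Rmax, Rmin. specialize (Hr i).
    repeat destruct Rle_dec; apply Rabs_le; lra. }
  set (q := fun i => 2 * Rpower (r i) (t - 1)).
  assert (Hq : forall i, 0 < q i)
    by (intros i; assert (h := exp_pos ((t - 1) * ln (r i))); unfold q, Rpower; lra).
  assert (Hqr : forall i, q i * (4 * r i) = 8 * Rpower (r i) t).
  { intros i. unfold q. rewrite <- (Rpower_1 (r i)) at 2 by apply Hr.
    replace (2 * Rpower (r i) (t - 1) * (4 * Rpower (r i) 1)) with
      (8 * (Rpower (r i) (t - 1) * Rpower (r i) 1)) by ring.
    rewrite <- Rpower_plus. do 2 f_equal. ring. }
  (* Subtracting the value at 0 bounds the terms by [8 r_i^t] for every [z], hence the series
     converges. *)
  set (term := fun z i => q i * (clamp i z - clamp i 0)).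
  assert (Hs : is_series (fun i => 8 * Rpower (r i) t) (8 * l)).
  { apply (is_series_scal 8 (fun i => Rpower (r i) t)). now apply is_series_Reals. }
  assert (Hconv : forall z, ex_series (term z)).
  { intros z. apply (@ex_series_le R_AbsRing R_CompleteNormedModule (term z)
      (fun i => 8 * Rpower (r i) t)); [|now exists (8 * l)].
    intros i. change (Rabs (term z i) <= 8 * Rpower (r i) t). unfold term.
    rewrite Rabs_mult, (Rabs_pos_eq (q i)), <- Hqr by (left; apply Hq).
    apply Rmult_le_compat_l; [left; apply Hq | apply Hcl4]. }
  set (Phi := fun z => Series (term z)).
  assert (Hdiff : forall x y, Phi y - Phi x = Series (fun i => q i * (clamp i y - clamp i x))).
  { intros x y; unfold Phi. rewrite <- Series_minus by apply Hconv.
    apply Series_ext; intros i; unfold term; ring. }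
  assert (Hex : forall x y, ex_series (fun i => q i * (clamp i y - clamp i x))).
  { intros x y. apply ex_series_ext with (fun i => minus (term y i) (term x i)).
    - intros i. unfold term. change (q i * (clamp i y - clamp i 0) - q i * (clamp i x - clamp i 0)
        = q i * (clamp i y - clamp i x)). ring.
    - now apply (ex_series_minus (term y) (term x)). }
  assert (Hterm : forall i x y, x <= y -> q i * (clamp i y - clamp i x) <= Phi y - Phi x).
  { intros i x y Hxy. rewrite Hdiff.
    assert (Hn : forall k, 0 <= q k * (clamp k y - clamp k x)).
    { intros k. apply Rmult_le_pos; [left; apply Hq|auto]. }
    eapply Rle_trans; [apply (term_le_sum (fun k => q k * (clamp k y - clamp k x)) i Hn)|].
    apply sum_incr; trivial.
    apply (is_series_Reals (fun k => q k * (clamp k y - clamp k x))).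
    apply Series_correct, Hex. }
  exists Phi; split; [|split].
  - intros x y Hxy. specialize (Hterm 0%nat x y Hxy).
    specialize (Hcl 0%nat x y Hxy). specialize (Hq 0%nat). nra.
  - rewrite Hdiff. apply Rle_lt_trans with (Series (fun i => 8 * Rpower (r i) t)).
    + apply Series_le; [|now exists (8 * l)].
      intros i; split.
      * apply Rmult_le_pos; [left; apply Hq | apply Hcl; lra].
      * rewrite <- Hqr. apply Rmult_le_compat_l; [left; apply Hq|].
        eapply Rle_trans; [apply Rle_abs | apply Hcl4].
    + rewrite (is_series_unique _ _ Hs). lra.
  - intros i x Hx Hx0.
    assert (Hc : U i (c i)) by (apply epsilon_spec; now exists x).
    assert (Hxc := HU i x (c i) Hx Hc). apply Rabs_le_between in Hxc.
    (* The first such [n] gives [r_i / 2 < 2^(-n) <= r_i]. The dyadic interval around [x] then lies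
       within [2 r_i] of [c i], where the density is full. *)
    destruct (dec_inh_nat_subset_has_unique_least_element (fun n => / 2 ^ n <= r i))
      as [n [[Hn Hmin] _]].
    + intros; apply classic.
    + destruct (exists_small_dyadic_scale (r i) (proj1 (Hr i))) as [n Hn].
      exists n. left; apply Hn; trivial.
    + destruct (dyadic_exists n x Hx0) as [j Hj]. exists n, j; split; trivial.
      assert (Hp := two_pow_inv_pos n). assert (Hw := dyl_width n j).
      assert (Hbig : r i < 2 * / 2 ^ n).
      { destruct n as [|n]; [specialize (Hr i); simpl; lra|].
        apply Rnot_le_lt; intros Hle.
        assert (S n <= n)%nat; [|lia]. apply Hmin.
        replace (/ 2 ^ n) with (2 * / 2 ^ S n); trivial.
        simpl; field. apply Rgt_not_eq, two_pow_pos. }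
      unfold saturated, mass. unfold dyadic in Hj.
      eapply Rle_trans; [|apply (Hterm i); lra].
      replace (clamp i (dyl n (S j)) - clamp i (dyl n j)) with (/ 2 ^ n).
      2:{ unfold clamp. rewrite !Rmin_left, !Rmax_right by lra. lra. }
      set (h := / 2 ^ n) in *. unfold q.
      (* It remains to compare densities: [h^(t-1) = 2^(1-t) (2h)^(t-1) <= 2 r_i^(t-1)], since
         [2h > r_i] and the exponent [t - 1] is negative. *)
      assert (E : Rpower h t = Rpower h (t - 1) * h).
      { rewrite <- (Rpower_1 h) at 3 by trivial. rewrite <- Rpower_plus. f_equal; ring. }
      rewrite E. apply Rmult_le_compat_r; [lra|].
      assert (H2 : Rpower h (t - 1) = Rpower 2 (1 - t) * Rpower (2 * h) (t - 1)).
      { rewrite <- Rpower_mult_distr, <- Rmult_assoc, <- Rpower_plus by lra.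
        replace (1 - t + (t - 1)) with 0 by ring. rewrite Rpower_O by lra. ring. }
      rewrite H2.
      assert (H3 : Rpower 2 (1 - t) <= 2).
      { rewrite <- (Rpower_1 2) at 2 by lra. apply Rle_Rpower; lra. }
      assert (H4 : Rpower (2 * h) (t - 1) <= Rpower (r i) (t - 1)).
      { replace (t - 1) with (- (1 - t)) by ring. rewrite !Rpower_Ropp.
        apply Rinv_le_contravar; [apply exp_pos|].
        apply Rle_Rpower_l; [lra|]. split; [apply Hr|lra]. }
      assert (H5 : 0 < Rpower (2 * h) (t - 1)) by apply exp_pos.
      assert (H6 : 0 < Rpower 2 (1 - t)) by apply exp_pos. nra.
Qed.

(** The inductive step of the construction. A point of [G] is pulled back through a cylinder inside
    a light subinterval; the prefixed digits do not change limit frequencies. *)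
Lemma approach_frequency (Phi : R -> R) (t : R) f g a (G : R -> Prop) w l n j N e :
  (forall x y, x <= y -> Phi x <= Phi y) -> 0 < t < 1 ->
  admissible_map f g a -> cond_i f g a ->
  ~ hausdorff_null t G ->
  (forall x, G x -> unit_int x /\ Un_cv (freq f g a w x) l) ->
  unsaturated_above Phi t n j -> dyl n (S j) <= 1 -> 0 < e ->
  exists n' j', (n < n')%nat /\ unsaturated_above Phi t n' j' /\
    dyl n j <= dyl n' j' /\ dyl n' (S j') < dyl n (S j) /\
    forall x, dyadic n' j' x -> exists M, (N <= M)%nat /\ Rabs (freq f g a w x M - l) < e.
Proof.
  intros Hm Ht Hadm [K [HK Hi]] Hnull HG Hok Hj1 He.
  destruct (zoom f g a Hadm K HK Hi) as [kappa [Hkappa Hzoom]].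
  destruct (zero_orbit_countable f g a Hadm) as [z Hz].
  destruct (not_null_uncovered_countable t G z (proj1 Ht) Hnull) as [e0 [He0 Hunc]].
  assert (Hkt : 0 < Rpower kappa t) by apply exp_pos.
  (* The iterate stretches the pieces by at most [cc = kappa 2^n1]; this mass bound makes the [t]-th
     powers of the stretched lengths sum to at most [e0]. *)
  destruct (unsaturated_low_mass Phi t Ht n j (e0 / Rpower kappa t) Hok)
    as [n1 [j1 [Hn1 [Hok1 [Hmass [Hlo Hhi]]]]]]; [now apply Rdiv_lt_0_compat|].
  assert (Hw := dyl_width n1 j1). assert (Hp := two_pow_inv_pos n1).
  assert (Hdyl0 : forall n j, 0 <= dyl n j).
  { intros n0 j0. apply Rdiv_le_0_compat; [apply pos_INR|apply two_pow_pos]. }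
  destruct (Hzoom (dyl n1 j1) (dyl n1 (S j1))) as [ww [Hval [Hin Hlip]]]; try lra; [apply Hdyl0|].
  rewrite Hw in Hlip.
  set (F := Nat.iter (length ww) f) in *.
  set (cc := kappa / / 2 ^ n1) in *.
  assert (Hcc : 0 < cc) by now apply Rdiv_lt_0_compat.
  destruct (Hunc (fun k y => exists x, cylinder f a ww x /\ F x = y /\ piece_set Phi t n1 j1 k x)
              (fun k => cc * piece_length Phi t n1 j1 k)) as [y [Gy [Hy Hyz]]].
  - intros k. apply Rmult_le_pos; [lra|apply piece_length_nonneg].
  - intros k y y' [x [Cx [<- Px]]] [x' [Cx' [<- Px']]].
    eapply Rle_trans; [now apply Hlip|]. apply Rmult_le_compat_l; [lra|].
    now apply piece_set_diam.
  - intros M. rewrite (sum_eq _ (fun k => rpow (piece_length Phi t n1 j1 k) t * Rpower cc t)).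
    2:{ intros k _. rewrite rpow_mult; trivial; [ring|apply piece_length_nonneg]. }
    rewrite <- scal_sum.
    apply Rle_trans with (Rpower cc t * (e0 / Rpower kappa t * Rpower (/ 2 ^ n1) t)).
    + apply Rmult_le_compat_l; [left; apply exp_pos|].
      eapply Rle_trans; [now apply piece_sum | exact Hmass].
    + replace (Rpower kappa t) with (Rpower cc t * Rpower (/ 2 ^ n1) t).
      * assert (h1 : 0 < Rpower cc t) by apply exp_pos.
        assert (h2 : 0 < Rpower (/ 2 ^ n1) t) by apply exp_pos.
        right. field. lra.
      * rewrite Rpower_mult_distr by trivial. f_equal. unfold cc. field.
        apply Rgt_not_eq, two_pow_pos.
  - destruct (HG y Gy) as [Uy Hcv].
    destruct (cylinder_onto f g a Hadm ww y Hval Uy) as [x [Cx Ex]]. fold F in Ex.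
    assert (Ux := proj1 Cx). assert (Hx1 : dyadic n1 j1 x) by now apply Hin.
    (* A saturated interval around [x] would put [x] in a piece and [y = F x] in its image, which
       [y] avoids. *)
    assert (Hns : forall n2 j2, dyadic n2 j2 x -> ~ saturated Phi t n2 j2).
    { intros n2 j2 H2 Hs.
      destruct (saturated_point_in_piece Phi t n1 j1 x n2 j2 (proj1 Ux) Hok1 Hx1 H2 Hs) as [k Hk].
      apply (Hy k). now exists x. }
    assert (Hnz : ~ zero_orbit f x).
    { intros H. apply (zero_orbit_iter f g a Hadm (length ww)) in H. fold F in H. rewrite Ex in H.
      destruct (Hz y Uy H) as [i Hyi]. now apply (Hyz i). }
    rewrite <- Ex in Hcv. apply freq_cv_iter in Hcv.
    destruct (Hcv e He) as [M HM].
    destruct (expansion_locally_constant f g a Hadm K HK Hi (Nat.max N M) x Ux Hnz)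
      as [d [Hd Hloc]].
    unfold dyadic in Hx1.
    (* [d] keeps the digits fixed; the distance to the right end makes the right endpoints decrease
       strictly. *)
    destruct (exists_small_dyadic_scale (Rmin d (dyl n (S j) - x))) as [n2 Hn2];
      [apply Rmin_glb_lt; lra|].
    set (n' := (S n + n2)%nat). specialize (Hn2 n' ltac:(lia)).
    assert (M1 := Rmin_l d (dyl n (S j) - x)). assert (M2 := Rmin_r d (dyl n (S j) - x)).
    destruct (dyadic_exists n' x (proj1 Ux)) as [j' Hj']. assert (Hw' := dyl_width n' j').
    exists n', j'; repeat split.
    + lia.
    + intros n3 j3 x3 Hn3 H3 H3'. apply Hns.
      assert (Hnest := dyadic_nested n3 n' j3 j' x3 Hn3 H3 H3'). unfold dyadic in *; lra.
    + apply (dyadic_nested n n' j j' x); trivial; [lia|]. unfold dyadic; lra.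
    + unfold dyadic in Hj'; lra.
    + intros x3 Hx3. exists (Nat.max N M); split; [lia|].
      destruct (Hloc x3) as [_ He3].
      * unfold dyadic in *. apply Rabs_def1; lra.
      * rewrite (freq_ext f g a w x3 x) by trivial. apply HM; lia.
Qed.

(** A set of dimension above [t] is not [t]-null. Condition (ii) with [delta = 1 - t] yields two
    such frequency sets that disagree at the word of [m] zeros. *)
Lemma two_frequencies f g a t m :
  admissible_map f g a -> cond_ii f g a -> 0 < t < 1 -> (1 <= m)%nat ->
  exists (w : list nat) (l : bool -> R),
    valid_word g w /\ length w = m /\ l true <> l false /\
    forall b, exists G, ~ hausdorff_null t G /\
      forall x, G x -> unit_int x /\ Un_cv (freq f g a w x) (l b).
Proof.
  intros [Hg _] Hii Ht Hm.
  destruct (Hii m Hm) as [p [_ [Hdp H]]].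
  set (w := repeat 0%nat m).
  assert (Hv : valid_word g w).
  { apply Forall_forall. intros k Hk. apply repeat_spec in Hk. lia. }
  assert (Hl : length w = m) by apply repeat_length.
  destruct (H w Hv Hl (1 - t) ltac:(lra)) as [q [_ [Hqp [d [Hdq Hd]]]]].
  assert (Hnn : forall p d, hausdorff_dim (freq_set f g a m p) d -> t < d ->
    ~ hausdorff_null t (freq_set f g a m p)).
  { intros p' d' [Hlb _] Htd Hn. specialize (Hlb t ltac:(split; trivial; lra)). lra. }
  exists w, (fun b => if b : bool then q w else p w). repeat split; trivial.
  intros [|].
  - exists (freq_set f g a m q); split; [apply (Hnn q d); trivial; lra|].
    intros x [Hx Hf]; auto.
  - exists (freq_set f g a m p); split; [apply (Hnn p 1); trivial; lra|].
    intros x [Hx Hf]; auto.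
Qed.

(** * Points that are normal to none of the maps *)

Section Nonnormal.

Variables (f : nat -> R -> R) (g : nat -> nat) (a : nat -> nat -> R).
Hypothesis Hadm : forall i, admissible_map (f i) (g i) (a i).
Hypothesis Hi : forall i, cond_i (f i) (g i) (a i).
Hypothesis Hii : forall i, cond_ii (f i) (g i) (a i).

Definition nonnormal (x : R) : Prop :=
  0 <= x < 1 /\ forall i m, (1 <= m)%nat -> ~ m_normal (f i) (g i) (a i) m x.

(** The limit point has oscillating frequencies, so the assumed cover must contain it and put it in
    a saturated interval, yet all dyadic intervals around it are unsaturated. *)
Lemma nonnormal_not_null t : 0 < t < 1 -> ~ hausdorff_null t nonnormal.
Proof.
  intros Ht Hnull.
  destruct (Hnull 1 (/ 8)) as [U [r [Hr [HU [Hcov [l [Hl Hl8]]]]]]]; try lra.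
  destruct (cover_potential t U r l Ht Hr HU Hl Hl8) as [Phi [Hmono [Hsmall Hsat]]].
  assert (Hdata : forall i m, exists wl : list nat * (bool -> R),
    valid_word (g i) (fst wl) /\ length (fst wl) = S m /\ snd wl true <> snd wl false /\
    forall b, exists G, ~ hausdorff_null t G /\
      forall x, G x -> unit_int x /\ Un_cv (freq (f i) (g i) (a i) (fst wl) x) (snd wl b)).
  { intros i m. destruct (two_frequencies (f i) (g i) (a i) t (S m)) as [w [lb H]]; trivial; [lia|].
    now exists (w, lb). }
  set (wl := fun i m => proj1_sig (constructive_indefinite_description _ (Hdata i m))).
  assert (Hwl : forall i m, valid_word (g i) (fst (wl i m)) /\ length (fst (wl i m)) = S m /\
    snd (wl i m) true <> snd (wl i m) false /\
    forall b, exists G, ~ hausdorff_null t G /\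
      forall x, G x -> unit_int x /\
        Un_cv (freq (f i) (g i) (a i) (fst (wl i m)) x) (snd (wl i m) b)).
  { intros i m; unfold wl; destruct constructive_indefinite_description; trivial. }
  (* Stage k serves the requirement coded by the first component of k, so that
     every requirement is served at arbitrarily late stages. *)
  set (req := fun k => Cantor.of_nat (fst (Cantor.of_nat k))).
  set (ri := fun k => fst (req k)).
  set (rm := fun k => fst (Cantor.of_nat (snd (req k)))).
  set (rb := fun k => Nat.even (snd (Cantor.of_nat (snd (req k))))).
  set (good := fun k x => exists M, (k <= M)%nat /\
    Rabs (freq (f (ri k)) (g (ri k)) (a (ri k)) (fst (wl (ri k) (rm k))) x M
          - snd (wl (ri k) (rm k)) (rb k)) < / INR (S k)).
  set (inv := fun p : nat * nat =>
    unsaturated_above Phi t (fst p) (snd p) /\ dyl (fst p) (S (snd p)) <= 1).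
  set (rel := fun k (p p' : nat * nat) => (fst p < fst p')%nat /\
    dyl (fst p) (snd p) <= dyl (fst p') (snd p') /\
    dyl (fst p') (S (snd p')) < dyl (fst p) (S (snd p)) /\
    forall x, dyadic (fst p') (snd p') x -> good k x).
  assert (Hstep : forall k p, inv p -> exists p', inv p' /\ rel k p p').
  { intros k [n j] [H1 H2]. simpl in H1, H2.
    destruct (Hwl (ri k) (rm k)) as [_ [_ [_ HG]]]. destruct (HG (rb k)) as [G [HG1 HG2]].
    destruct (approach_frequency Phi t (f (ri k)) (g (ri k)) (a (ri k)) G
      (fst (wl (ri k) (rm k))) (snd (wl (ri k) (rm k)) (rb k)) n j k (/ INR (S k)))
      as [n' [j' [P1 [P2 [P3 [P4 P5]]]]]]; trivial.
    - apply Rinv_0_lt_compat, lt_0_INR; lia.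
    - exists (n', j'). unfold inv, rel; simpl. repeat split; trivial; lra. }
  set (st := fix st k := match k with
    | O => (0%nat, 0%nat)
    | S k => epsilon (inhabits (0%nat, 0%nat)) (fun p' => inv p' /\ rel k (st k) p')
    end).
  assert (D0 : dyl 0 0 = 0) by (unfold dyl; simpl; field).
  assert (D1 : dyl 0 1 = 1) by (unfold dyl; simpl; field).
  assert (Hinv : forall k, inv (st k)).
  { induction k as [|k IH].
    (* The start [0,1) is unsaturated because [Phi 1 - Phi 0 < 1]. *)
    - split; simpl; [|lra]. intros n' j' x Hn' Hx Hx'.
      replace n' with 0%nat in * by lia.
      rewrite (dyadic_unique 0 j' 0 x) by trivial.
      unfold saturated, mass. rewrite D0, D1. simpl.
      unfold Rpower. rewrite Rinv_1, ln_1, Rmult_0_r, exp_0. lra.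
    - cbn [st]. apply (epsilon_spec _ (fun p' => inv p' /\ rel k (st k) p')). auto. }
  assert (Hrel : forall k, rel k (st k) (st (S k))).
  { intros k. cbn [st].
    apply (epsilon_spec _ (fun p' => inv p' /\ rel k (st k) p')). auto. }
  destruct (limit_point (fun k => dyl (fst (st k)) (snd (st k)))
              (fun k => dyl (fst (st k)) (S (snd (st k))))) as [x Hx].
  { intros k. assert (h1 := dyl_width (fst (st k)) (snd (st k))).
    assert (h2 := two_pow_inv_pos (fst (st k))). lra. }
  { intros k. apply (Hrel k). }
  { intros k. apply (Hrel k). }
  (* Hence the generation [k] dyadic interval around [x] is an ancestor of stage [k], or equal to
     it, and so unsaturated. *)
  assert (Hlev : forall k, (k <= fst (st k))%nat).
  { induction k as [|k IH]; [lia|]. destruct (Hrel k) as [h _]. lia. }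
  assert (Ux : 0 <= x < 1).
  { specialize (Hx 0%nat). cbn [st fst snd] in Hx. lra. }
  destruct (Hcov x) as [i Hxi].
  - split; trivial. intros i m Hm Hnorm. destruct m as [|m]; [lia|].
    destruct (Hwl i m) as [Hv [Hlen [Hne _]]].
    destruct (Hnorm (fst (wl i m)) Hv Hlen) as [L [_ HL]].
    (* A limit frequency [L] would have to equal both targets, as each is approached at arbitrarily
       late times. *)
    assert (Heq : forall b, snd (wl i m) b = L).
    { intros b. apply cond_eq. intros e He.
      destruct (HL (e / 2)) as [N HN]; [lra|].
      destruct (archimed_cor1 (e / 2)) as [N2 [HN2 HN2p]]; [lra|].
      (* The second component makes [k] large, since a Cantor code is at least each of its
         components; parity encodes [b]. *)
      set (k := Cantor.to_nat (Cantor.to_nat (i, Cantor.to_nat (m, if b then 0%nat else 1%nat)),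
                 Nat.max N N2)).
      assert (Hk : (Nat.max N N2 <= k)%nat).
      { unfold k. eapply Nat.le_trans; [|apply Cantor.to_nat_non_decreasing]. lia. }
      assert (Hgood : good k x) by (apply (Hrel k); apply (Hx (S k))).
      unfold good in Hgood.
      assert (E1 : ri k = i)
        by (unfold ri, req, k; repeat (rewrite Cantor.cancel_of_to; cbn [fst snd]); reflexivity).
      assert (E2 : rm k = m)
        by (unfold rm, req, k; repeat (rewrite Cantor.cancel_of_to; cbn [fst snd]); reflexivity).
      assert (E3 : rb k = b)
        by (unfold rb, req, k; repeat (rewrite Cantor.cancel_of_to; cbn [fst snd]); now destruct b).
      rewrite E1, E2, E3 in Hgood. destruct Hgood as [M [HkM HM]].
      specialize (HN M ltac:(lia)). unfold Rdist in HN.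
      assert (Hinvk : / INR (S k) <= / INR N2).
      { apply Rinv_le_contravar; [now apply lt_0_INR|apply le_INR; lia]. }
      rewrite Rabs_minus_sym in HM.
      replace (snd (wl i m) b - L) with
        (snd (wl i m) b - freq (f i) (g i) (a i) (fst (wl i m)) x M
         + (freq (f i) (g i) (a i) (fst (wl i m)) x M - L)) by ring.
      eapply Rle_lt_trans; [apply Rabs_triang|]. lra. }
    apply Hne. now rewrite !Heq.
  - destruct (Hsat i x Hxi (proj1 Ux)) as [n [j [Hd Hs]]].
    destruct (Hinv n) as [Hok _]. apply (Hok n j x); trivial. apply (Hx n).
Qed.

End Nonnormal.

Theorem mainTheorem1
  (f : nat -> R -> R) (g : nat -> nat) (a : nat -> nat -> R)
  (Hadm : forall i, admissible_map (f i) (g i) (a i))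
  (Hi : forall i, cond_i (f i) (g i) (a i))
  (Hii : forall i, cond_ii (f i) (g i) (a i)) :
  hausdorff_dim
    (fun x => 0 <= x < 1 /\
       forall i m, (1 <= m)%nat -> ~ m_normal (f i) (g i) (a i) m x)
    1.
Proof.
  change (hausdorff_dim (nonnormal f g a) 1). split.
  - intros s [Hs Hnull]. apply Rnot_lt_le; intros Hs1.
    (* The midpoint lies strictly between 0 and 1 even when [s = 0]. *)
    apply (nonnormal_not_null f g a Hadm Hi Hii ((s + 1) / 2)); [lra|].
    apply hausdorff_null_mono_exponent with s; trivial; lra.
  - intros d' Hd'. apply Rnot_lt_le; intros Hlt.
    (* A lower bound [d' > 1] would exceed the midpoint of 1 and [d'], an exponent above 1 at which
       the set is null. *)
    assert (d' <= (1 + d') / 2); [|lra].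
    apply Hd'. split; [lra|]. apply unit_interval_null; [lra|]. now intros x [Hx _].
Qed.
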